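(* Let $p>2$ and $b>1$. For any $\alpha<4\pi$ and any $M>0$, $$\sup_{u\in X,\ \|\nabla u\|_2\le1,\ \|u\|_{*,p}\le M}\ \int_{\mathbb R^2}|u|^p e^{\alpha u^2}\ln(b+|x|)\,dx=C(\alpha,M)<+\infty.$$
   Context: $X=D^{1,2}L^p_\omega(\mathbb R^2)$ is the space of $u\in L^1_{\rm loc}(\mathbb R^2)$ with $\nabla u\in L^2(\mathbb R^2)$ and $\|u\|_{*,p}:=\big(\int_{\mathbb R^2}|u|^p\ln(b+|x|)\,dx\big)^{1/p}<+\infty$. *)

(* Defs.v *)
From HB Require Import structures.
From mathcomp Require Import all_boot all_order all_algebra.
From mathcomp Require Import all_classical all_reals all_analysis.

Set Implicit Arguments.
Unset Strict Implicit.
Unset Printing Implicit Defensive.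

Import Order.TTheory GRing.Theory Num.Theory.
Import numFieldNormedType.Exports.

Local Open Scope classical_set_scope.
Local Open Scope ring_scope.

(* A notation rather than a constant, so that the canonical (sigma-finite)
   measure structure of the product stays visible to unification. *)
Notation lebesgue2 R := (@lebesgue_measure R \x @lebesgue_measure R)%E.

Section plane.
Context {R : realType}.
Implicit Types (u g phi : R * R -> R) (G : R * R -> R * R) (p b : R).

(* The canonical norm on the normed module [R * R] is the sup norm. *)
Definition enorm (x : R * R) : R := Num.sqrt (x.1 ^+ 2 + x.2 ^+ 2).

Definition e1 : R * R := (1, 0).
Definition e2 : R * R := (0, 1).

Fixpoint Ck (k : nat) phi : Prop :=
  if k is k'.+1 then
    [/\ continuous phi,
        (forall x, derivable phi x e1 /\ derivable phi x e2),
        Ck k' (fun x => 'D_e1 phi x) &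
        Ck k' (fun x => 'D_e2 phi x)]
  else continuous phi.

Definition test_function phi : Prop :=
  (forall k, Ck k phi) /\ compact (closure [set x | phi x != 0]).

(* Borel representatives; every Lebesgue measurable function has one. *)
Definition locally_integrable2 u : Prop :=
  measurable_fun [set: measurableTypeR R * measurableTypeR R] u /\
  forall K : set (R * R), compact K ->
    (\int[lebesgue2 R]_(x in K) `|u x|%:E < +oo)%E.

Definition is_weak_partial (e : R * R) u g : Prop :=
  forall phi, test_function phi ->
    (\int[lebesgue2 R]_x (u x * 'D_e phi x)%:E =
     - \int[lebesgue2 R]_x (g x * phi x)%:E)%E.

Definition is_weak_gradient u G : Prop :=
  [/\ locally_integrable2 (fun x => (G x).1),
      locally_integrable2 (fun x => (G x).2),
      is_weak_partial e1 u (fun x => (G x).1) &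
      is_weak_partial e2 u (fun x => (G x).2)].

(* Unique up to a null set when it exists; arbitrary otherwise. *)
Definition weak_gradient u : R * R -> R * R := get (is_weak_gradient u).

Definition gradnorm2 u : \bar R :=
  Lnorm (lebesgue2 R) 2%:E (fun x => (enorm (weak_gradient u x))%:E).

Definition wnorm p b u : \bar R :=
  ((\int[lebesgue2 R]_x (`|u x| `^ p * ln (b + enorm x))%:E) `^ p^-1)%E.

Definition D12Lp p b : set (R * R -> R) :=
  [set u | [/\ locally_integrable2 u,
               (exists G, is_weak_gradient u G),
               (gradnorm2 u < +oo)%E &
               (wnorm p b u < +oo)%E]].

End plane.

(* Main.v *)
(* A Hedberg-type argument, without rearrangement. Let k_c be a smooth bump
   supported in c <= |y - x|^2 <= 2c. Truncating (y - x) / (2 pi |y - x|^2)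
   smoothly to a <= |y - x|^2 <= 2c gives a test field of divergence k_a - k_c;
   pairing it with the weak gradient and letting a tend to 0 yields, for almost
   every x and every c > 0,
     |u(x)| <= |k_c * u(x)| + (2 pi)^-1 I(x),
     I(x) = \int_{|y - x|^2 < 2c} |grad u(y)| / |y - x| dy.
   Take c = 1 / w(x) with w(x) = ln(b + |x|). On that disc w is comparable to
   w(x), so the average is bounded in terms of the weighted L^p norm. Let V(x)
   be the integral of |grad u(y)|^2 (|y - x|^2 w(x))^(-s) over the disc. The
   weighted Cauchy-Schwarz inequality with weight
   1 + e (|y - x|^2 w(x))^(-s) / (1 + V(x)) gives
     I(x)^2 <= (1 + e) (pi / s) ln(1 + C (1 + V(x))).
   If alpha < 4 pi, choose s < 1 close to 1 and e small: then
   |u|^p exp(alpha u^2) <= C (|u|^p + V), and the integral of V w is bounded by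
   Tonelli's theorem. *)
Require Import Defs.
From HB Require Import structures.
From mathcomp Require Import all_boot all_order all_algebra.
From mathcomp Require Import all_classical all_reals all_analysis.
From mathcomp Require Import measurable_realfun.
From mathcomp Require Import ring lra.
Set Implicit Arguments.
Unset Strict Implicit.
Unset Printing Implicit Defensive.
Import Order.TTheory GRing.Theory Num.Theory.
Import numFieldNormedType.Exports.
Local Open Scope classical_set_scope.
Local Open Scope ring_scope.

(** The constant 4 pi is the product of two factors. The representation carries (2 pi)^-1 and the
    estimate of I^2 carries pi / s, so J = (2 pi)^-1 I satisfies 4 pi s J^2 <= (1 + e) ln(1 + C (1 +
    V)). Hence exp(beta u^2) is at most linear in V once (1 + e)^2 beta <= 4 pi s. Linear growth is
    what can be afforded: only the first power of V, times w, is integrated. The gap between alpha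
    and 4 pi pays for three losses: s < 1, without which |y - x|^(-2 s) is not locally integrable;
    the cross term between the average and I; and the factor |u|^p where |u| >= 1. Where |u| < 1 the
    exponential is bounded and |u|^p gives integrability at infinity; where |u| >= 1 that factor
    absorbs the constant in 1 + V. The radius tied to w(x) makes the constants independent of x,
    since the powers of w cancel in each estimate. The limit a -> 0 is split in two. Where the
    potential is finite, which is almost everywhere, the averages converge by dominated convergence;
    the limit is then recognised as u by comparing integrals over rectangles. *)

Notation plane R := (measurableTypeR R * measurableTypeR R)%type.

(** * The plane measure as a sigma-finite measure *)

Section leb2.
Context {R : realType}.

Let lebesgue2_sigma_finite : sigma_finite [set: plane R] (lebesgue2 R).
Proof.
have /sigma_finiteP[F [TF ndF Foo]] := sigma_finiteT (@lebesgue_measure R).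
exists (fun n => F n `*` F n).
  rewrite -setXTT TF predeqE => -[x y]; split.
    move=> [/= [n _ Fnx] [k _ Gky]]; exists (maxn n k) => //; split.
    - by move: x Fnx; exact/subsetPset/ndF/leq_maxl.
    - by move: y Gky; exact/subsetPset/ndF/leq_maxr.
  by move=> [n _ []/= ? ?]; split; exists n.
move=> k; have [? ?] := Foo k.
split; first exact: measurableX.
by rewrite product_measure1E// lte_mul_pinfty// ge0_fin_numE.
Qed.

(* The library equips [m1 \x m2] with a canonical sigma-finite structure only
   when both factors are subprobabilities. *)
Definition leb2 : set (plane R) -> \bar R := lebesgue2 R.

HB.instance Definition _ := Measure.copy leb2 (lebesgue2 R).
HB.instance Definition _ := Measure_isSigmaFinite.Build _ _ _ leb2
  lebesgue2_sigma_finite.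

End leb2.

(** * Integration of radial functions *)

Section disc.
Context {R : realType}.
Implicit Types (x y : plane R) (t : R).

Definition sqdist x y : R := (y.1 - x.1) ^+ 2 + (y.2 - x.2) ^+ 2.

(** Area of a disc as the integral of its chords: the substitution [y = c + r sin s] turns the chord
    length into [2 r cos s], with Jacobian [r cos s]. *)
Lemma half_disc_integral (c r : R) : 0 < r ->
  (\int[lebesgue_measure]_(y in `[(c - r)%R, (c + r)%R])
     (2 * Num.sqrt (r ^+ 2 - (y - c) ^+ 2))%:E = (pi * r ^+ 2)%:E)%E.
Proof.
move=> r0.
pose F (s : R) := c + r * sin s.
have pi2 : 0 < pi / 2 :> R by rewrite divr_gt0 ?pi_gt0.
have dF (s : R) : is_derive s 1 F (r * cos s).
  rewrite /F; apply: is_derive_eq; rewrite add0r.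
  by rewrite mul1r.
have F'E : F^`()%classic = (fun s => r * cos s).
  by apply/funext => s; rewrite derive1E; apply: derive_val.
have cF : continuous F.
  by move=> s; apply: differentiable_continuous; apply/derivable1_diffP; apply: (@ex_derive _ _ _ _ _ _ _ (dF s)).
have cF' : continuous (fun s => r * cos s).
  by move=> s; apply: cvgM; [exact: cvg_cst|exact: continuous_cos].
have cG : continuous (fun y : R => 2 * Num.sqrt (r ^+ 2 - (y - c) ^+ 2)).
  move=> y; apply: cvgM; first exact: cvg_cst.
  apply: (@continuous_comp _ _ _ (fun y : R => r ^+ 2 - (y - c) ^+ 2) Num.sqrt); last exact: sqrt_continuous.
  apply: cvgB; first exact: cvg_cst.
  by rewrite /= expr2; apply: cvgM; apply: cvgB => //; exact: cvg_cst.
have ccos : continuous (@cos R) by exact: continuous_cos.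
have -> : c - r = F (- (pi / 2)) by rewrite /F sinN sin_pihalf mulrN1.
have -> : c + r = F (pi / 2) by rewrite /F sin_pihalf mulr1.
rewrite (@integration_by_substitution_increasing _ F) //=.
- rewrite F'E.
  transitivity (\int[lebesgue_measure]_(s in `[(- (pi / 2))%R, (pi / 2)%R])
      (2 * r ^+ 2 * cos s ^+ 2)%:E)%E.
    apply: eq_integral => s; rewrite inE /= in_itv /= => sI.
    rewrite mulrfctE /F /= addrAC subrr add0r exprMn -[X in X - _]mulr1 -mulrBr.
    rewrite -cos2sin2 -exprMn sqrtr_sqr ger0_norm.
      by congr EFin; ring.
    by rewrite mulr_ge0 ?(ltW r0)// cos_ge0_pihalf.
  (* A primitive, because [1 + cos^2 s - sin^2 s = 2 cos^2 s]. *)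
  pose P (s : R) := r ^+ 2 * (s + sin s * cos s).
  have dP (s : R) : is_derive s 1 P (2 * r ^+ 2 * cos s ^+ 2).
    rewrite /P; apply: is_derive_eq.
    by rewrite /GRing.scale/= -{1}(cos2Dsin2 s); ring.
  have cP : continuous P.
    by move=> s; apply: differentiable_continuous; apply/derivable1_diffP; apply: (@ex_derive _ _ _ _ _ _ _ (dP s)).
  rewrite (@continuous_FTC2 _ _ P).
  + rewrite /P sinN sin_pihalf cosN cos_pihalf !mulr0 !addr0 -EFinB.
    by congr EFin; field.
  + by rewrite gtrN.
  + apply: continuous_subspaceT => s; apply: cvgM; first exact: cvg_cst.
    by rewrite /= expr2; apply: cvgM; exact: ccos.
  + split.
    * by move=> s _; apply: (@ex_derive _ _ _ _ _ _ _ (dP s)).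
    * exact/cvg_at_right_filter/cP.
    * exact/cvg_at_left_filter/cP.
  + by move=> s _; rewrite derive1E; apply: derive_val.
- by rewrite ge0_cp //= ltW.
- move=> s u; rewrite !in_itv /= => sI uI su.
  by rewrite /F ltrD2l ltr_pM2l//; rewrite ltr_sin.
- by rewrite F'E => s _; exact: cF'.
- by rewrite F'E; apply/cvg_ex; eexists; exact/cvg_at_right_filter/cF'.
- by rewrite F'E; apply/cvg_ex; eexists; exact/cvg_at_left_filter/cF'.
- split.
  + by move=> s _; apply: (@ex_derive _ _ _ _ _ _ _ (dF s)).
  + exact/cvg_at_right_filter/cF.
  + exact/cvg_at_left_filter/cF.
- exact: continuous_subspaceT cG.
Qed.

Lemma measurable_sqdist : measurable_fun [set: plane R * plane R] (fun z => sqdist z.1 z.2).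
Proof.
by apply: measurable_funD; apply: measurable_funX; apply: measurable_funB;
  apply: measurableT_comp => //=; apply: measurableT_comp.
Qed.

Lemma measurable_sqdist1 x : measurable_fun [set: plane R] (sqdist x).
Proof.
apply: (measurableT_comp measurable_sqdist (measurable_pair1 x)).
Qed.

(** The product measure integrates the lengths of vertical sections. As [Num.sqrt] is 0 on negative
    numbers, the length [2 * s y] is right also for abscissas that miss the disc. *)
Lemma leb2_disc x t : 0 <= t -> leb2 [set y | sqdist x y < t] = (pi * t)%:E.
Proof.
rewrite le_eqVlt => /predU1P[<-|t0].
  rewrite mulr0 (_ : [set _ | _] = set0) ?measure0//.
  by apply/seteqP; split => // y /=; rewrite ltNge addr_ge0 ?sqr_ge0.
pose r := Num.sqrt t.
have r0 : 0 < r by rewrite sqrtr_gt0.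
have tE : t = r ^+ 2 by rewrite sqr_sqrtr // ltW.
pose s (y : R) := Num.sqrt (t - (y - x.1) ^+ 2).
have secE (y : R) : lebesgue_measure (xsection [set y | sqdist x y < t] y) = (2 * s y)%:E.
  rewrite /xsection.
  have -> : [set z | (y, z) \in [set y | sqdist x y < t]] =
      `](x.2 - s y), (x.2 + s y)[%classic.
    rewrite predeqE => z; rewrite /= in_itv/= inE /= /sqdist/=.
    rewrite -ltr_distl /s -sqrtr_sqr -ltrBrDl; split => h.
      by rewrite ltr_sqrt// (le_lt_trans _ h) ?sqr_ge0.
    rewrite -ltr_sqrt//; have := le_lt_trans (sqrtr_ge0 _) h.
    by rewrite sqrtr_gt0.
  rewrite lebesgue_measure_itv /= lte_fin.
  have := sqrtr_ge0 (t - (y - x.1) ^+ 2); rewrite -/(s y) le_eqVlt => /predU1P[<-|s0].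
    by rewrite subr0 addr0 ltxx mulr0.
  rewrite ifT; last by lra.
  by rewrite -EFinB; congr EFin; lra.
transitivity (\int[lebesgue_measure]_z (2 * s z)%:E)%E.
  by apply: eq_integral => z _; exact: secE.
transitivity (\int[lebesgue_measure]_(z in `[(x.1 - r)%R, (x.1 + r)%R]) (2 * s z)%:E)%E.
  rewrite [RHS]integral_mkcond; apply: eq_integral => y _.
  rewrite patchE; case: ifPn => //; rewrite notin_setE /= in_itv/= => /negP.
  rewrite -ler_distl -ltNge => h; rewrite /s ler0_sqrtr ?mulr0// subr_le0 tE.
  by rewrite -[leRHS]real_normK ?num_real// ler_sqr ?nnegrE ?normr_ge0 ?(ltW r0) ?(ltW h).
by rewrite tE -(half_disc_integral x.1) // /s tE.
Qed.

(** Polar coordinates in the variable [t = |y - x|^2], where the density is constant. By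
    [leb2_disc], the image of [leb2] under [sqdist x] and [pi] times Lebesgue measure on the
    half-line agree on the rays []-oo, t[], which are stable under intersection and generate the
    Borel sets. *)
Lemma integral_sqdist x (G : R -> \bar R) :
  measurable_fun [set: R] G -> (forall t, 0 <= G t)%E ->
  (\int[leb2]_y G (sqdist x y) = pi%:E * \int[lebesgue_measure]_(t in `[0%R, +oo[) G t)%E.
Proof.
move=> mG G0.
have mI : measurable (`[0%R, +oo[%classic : set (measurableTypeR R)) by exact: measurable_itv.
have mx : measurable_fun [set: plane R] (sqdist x : plane R -> measurableTypeR R).
  exact: measurable_sqdist1.
pose msq : {mfun plane R >-> measurableTypeR R} :=
  HB.pack (sqdist x : plane R -> measurableTypeR R)
    (isMeasurableFun.Build _ _ _ _ _ mx).
pose L := mscale (NngNum (pi_ge0 R)) (mrestr (@lebesgue_measure R) mI).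
have NL (A : set (measurableTypeR R)) : measurable A -> pushforward leb2 msq A = L A.
  apply: (@measure_unique _ _ (measurableTypeR R) (@RGenInftyO.G R)
    (fun n => `]-oo, n%:R[%classic) _ _ _ _ (pushforward leb2 msq) L).
  - exact: RGenInftyO.measurableE.
  - move=> _ _ [a ->] [b ->]; exists (Num.min a b).
    by rewrite predeqE => z; rewrite /= !in_itv/= lt_min; split=> [[-> ->]|/andP[-> ->]].
  - by move=> n; exists n%:R.
  - rewrite -subTset => z _; exists (Num.truncn `|z|).+1 => //=.
    by rewrite in_itv/= (le_lt_trans (ler_norm _))// truncnS_gt.
  - move=> _ [t ->].
    transitivity (leb2 [set y | sqdist x y < t]).
      by congr leb2; rewrite predeqE => y; rewrite /= in_itv.
    rewrite [RHS](_ : _ = pi%:E * lebesgue_measure (`]-oo, t[ `&` `[0%R, +oo[))%E; last by [].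
    have [t0|t0] := leP t 0.
      rewrite (_ : [set y | _] = set0) ?measure0; last first.
        rewrite predeqE => y; split => //= /lt_le_trans => /(_ _ t0).
        by rewrite ltNge addr_ge0 ?sqr_ge0.
      rewrite [X in lebesgue_measure X](_ : _ = set0) ?measure0 ?mule0//.
      rewrite predeqE => z; split => //=; rewrite !in_itv/= andbT => -[] h1 h2.
      by have := lt_le_trans h1 t0; rewrite ltNge h2.
    rewrite leb2_disc ?ltW// [X in lebesgue_measure X](_ : _ = `[0%R, t[%classic); last first.
      by rewrite predeqE => z; rewrite /= !in_itv/= andbT; split=> [[-> ->]|/andP[-> ->]].
    by rewrite lebesgue_measure_itv/= lte_fin t0 oppr0 addr0.
  - move=> n.
    rewrite [X in (X < _)%E](_ : _ = leb2 [set y | sqdist x y < n%:R]); last first.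
      by congr leb2; rewrite predeqE => y; rewrite /= in_itv.
    by rewrite leb2_disc ?ltry.
pose L' := mscale (NngNum (pi_ge0 R)) (@lebesgue_measure R).
transitivity (\int[pushforward leb2 msq]_(t in `[0%R, +oo[) G t)%E.
  rewrite ge0_integral_pushforward//; last exact: measurable_funTS.
  rewrite [X in _ = integral _ X _](_ : _ = setT)//.
  apply/seteqP; split => // y _ /=.
  by rewrite in_itv/= andbT addr_ge0 ?sqr_ge0.
rewrite (eq_measure_integral L'); last first.
  move=> A mA AD; rewrite /= NL// /L /L' /mscale/= /mrestr setIidl//.
by rewrite /L' ge0_integral_mscale//; exact: measurable_funTS.
Qed.

End disc.

Section radial.
Context {R : realType}.
Implicit Types (x y : plane R) (t : R).

Definition disc x t : set (plane R) := [set y | sqdist x y < t].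

Lemma measurable_disc x t : measurable (disc x t).
Proof.
rewrite -[disc x t]setTI; have := measurable_sqdist1 x.
move=> /(_ measurableT `]-oo, t[%classic (measurable_itv _)).
by congr (measurable (_ `&` _)); rewrite predeqE => y; rewrite /= in_itv.
Qed.

Lemma sqdist_ge0 x y : 0 <= sqdist x y.
Proof. by rewrite addr_ge0 ?sqr_ge0. Qed.

(** Since [f] may be unbounded near 0, the fundamental theorem is applied on [[a n, b]]; dropping
    [F (a n) >= 0] and letting [a n] decrease to 0 gives the bound by monotone convergence. *)
Lemma integral_antiderivative_le (f F : R -> R) (b : R) : 0 < b ->
  (forall t, 0 < t -> 0 <= f t) -> (forall t, 0 < t -> 0 <= F t) ->
  (forall t, 0 < t -> {for t, continuous f}) ->
  (forall t, 0 < t -> is_derive t 1 F (f t)) ->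
  (\int[lebesgue_measure]_(t in `]0%R, b]) (f t)%:E <= (F b)%:E)%E.
Proof.
move=> b0 f0 F0 cf dF.
have cF t : 0 < t -> {for t, continuous F}.
  move=> t0; apply: differentiable_continuous; apply/derivable1_diffP.
  by apply: (@ex_derive _ _ _ _ _ _ _ (dF t t0)).
have mf : measurable_fun (`]0%R, b] : set (measurableTypeR R)) f.
  have : measurable_fun (`]0%R, +oo[ : set (measurableTypeR R)) f.
    apply: open_continuous_measurable_fun => //.
    by move=> t; rewrite inE/= in_itv/= andbT; exact: cf.
  apply: measurable_funS => //.
  by move=> t /=; rewrite !in_itv/= => /andP[-> _].
pose a n : R := b / n.+2%:R.
have a0 n : 0 < a n by rewrite divr_gt0.
have ab n : a n < b by rewrite ltr_pdivrMr// ltr_pMr// ltr1n.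
have EF : `]0%R, b]%classic = \bigcup_n `[a n, b]%classic.
  rewrite predeqE => t; split=> /=.
    rewrite in_itv/= => /andP[t0 tb].
    exists (Num.truncn (b / t)) => //=; rewrite in_itv/= tb andbT.
    rewrite ler_pdivrMr// mulrC -ler_pdivrMr// ltW// (lt_trans (truncnS_gt _))//.
    by rewrite ltr_nat.
  by move=> [n _] /=; rewrite !in_itv/= => /andP[ant ->]; rewrite (lt_le_trans (a0 n)).
have nd : nondecreasing_seq (fun n => `[a n, b]%classic).
  move=> m n mn; apply/subsetPset => t /=; rewrite !in_itv/= => /andP[amt ->].
  rewrite andbT (le_trans _ amt)// ler_pM2l// lef_pV2 ?posrE//.
  by rewrite ler_nat.
have ian n t : `[a n, b]%classic t -> `]0%R, b]%classic t.
  by move=> /=; rewrite !in_itv/= => /andP[ant ->]; rewrite (lt_le_trans (a0 n)).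
have cvgI := @ge0_nondecreasing_set_cvg_integral _ (measurableTypeR R) _
  (fun n => `[a n, b]%classic) (EFin \o f) (@lebesgue_measure R) nd
  (fun n => measurable_itv `[a n, b]).
have {}cvgI : ((\int[lebesgue_measure]_(t in `[a n, b]) (f t)%:E)%E @[n --> \oo]
    --> (\int[lebesgue_measure]_(t in `]0%R, b]) (f t)%:E)%E).
  rewrite EF; apply: cvgI => [n|n t /ian /=].
    by apply/measurable_EFinP; apply: measurable_funS mf => // t /ian.
  by rewrite in_itv/= lee_fin => /andP[t0 _]; exact: f0.
rewrite -(cvg_lim _ cvgI)//; apply: lime_le; first by apply/cvg_ex; eexists; exact: cvgI.
apply: nearW => n /=; rewrite (@continuous_FTC2 _ f F)//.
- by rewrite lee_fin lerBlDr lerDl F0.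
- apply: continuous_in_subspaceT => t; rewrite inE => /ian/=; rewrite in_itv/= => /andP[t0 _].
  exact: cf.
- split.
  + move=> t; rewrite in_itv/= => /andP[t0 _].
    by apply: (@ex_derive _ _ _ _ _ _ _ (dF t _)); rewrite (lt_trans (a0 n)).
  + exact/cvg_at_right_filter/cF.
  + exact/cvg_at_left_filter/cF.
- move=> t; rewrite in_itv/= => /andP[t0 _]; rewrite derive1E.
  by have := dF t (lt_trans (a0 n) t0) => ?; apply: derive_val.
Qed.

Lemma integral_disc_le x (f F : R -> R) (b : R) : 0 < b ->
  measurable_fun [set: R] f ->
  (forall t, 0 <= f t) -> (forall t, 0 < t -> 0 <= F t) ->
  (forall t, 0 < t -> {for t, continuous f}) ->
  (forall t, 0 < t -> is_derive t 1 F (f t)) ->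
  (\int[leb2]_(y in disc x b) (f (sqdist x y))%:E <= (pi * F b)%:E)%E.
Proof.
move=> b0 mf f0 F0 cf dF.
pose G := (EFin \o f) \_ `]-oo, b[.
have G0 t : (0 <= G t)%E.
  by rewrite /G patchE; case: ifP => // _; rewrite lee_fin.
have mG : measurable_fun [set: R] G.
  apply/(measurable_restrictT _ _).1 => //.
  exact/measurable_EFinP/measurable_funTS.
have -> : (\int[leb2]_(y in disc x b) (f (sqdist x y))%:E =
    \int[leb2]_y G (sqdist x y))%E.
  rewrite integral_mkcond; apply: eq_integral => y _.
  by rewrite /G !patchE; congr (if _ then _ else _); apply/idP/idP; rewrite !inE/= in_itv.
rewrite integral_sqdist// EFinM lee_pmul2l ?lte_fin ?pi_gt0//.
apply: le_trans; last first.
  apply: (integral_antiderivative_le b0 (fun t _ => f0 t) F0 cf dF).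
(* Single points are null: 0 is removed on the left because [F] is a primitive for [t > 0] only, and
   [b] on the right because the disc is open. *)
rewrite -integral_itv_obnd_cbnd; last exact: measurable_funTS.
rewrite -[leRHS]integral_itv_bndo_bndc; last exact/measurable_EFinP/measurable_funTS.
rewrite [leLHS]integral_mkcond [leRHS]integral_mkcond.
rewrite le_eqVlt; apply/orP; left; apply/eqP; apply: eq_integral => t _.
rewrite /G !patchE; case: ifPn; rewrite ?notin_setE ?inE/= !in_itv/= ?andbT => t0; last first.
  case: ifPn => //; rewrite inE/= in_itv/= => /andP[t0' _]; by [].
case: ifPn; rewrite ?notin_setE ?inE/= !in_itv/= => tb.
  by rewrite mem_set//= in_itv/= t0 tb.
case: ifPn => //; rewrite inE/= in_itv/= => /andP[_ tb1]; by case: tb.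
Qed.

Lemma measurable_funV_ge0 d (T : measurableType d) (D : set T) (f : T -> R) :
  (forall z, 0 <= f z) -> measurable_fun D f -> measurable_fun D (fun z => (f z)^-1).
Proof.
move=> f0 mf; rewrite (_ : (fun z => _) = (fun t : R => t `^ (-1)) \o f).
  by apply: measurableT_comp => //; exact: measurable_powR.
by apply/funext => z /=; rewrite powR_inv1.
Qed.

(** Used with [s = 1/2] for the kernel [1 / |y - x|], and with the exponent [s] of the local
    energy. *)
Lemma integral_disc_powR x (s b : R) : 0 < s -> s < 1 -> 0 < b ->
  (\int[leb2]_(y in disc x b) (sqdist x y `^ (- s))%:E <=
   (pi * (b `^ (1 - s) / (1 - s)))%:E)%E.
Proof.
move=> s0 s1 b0.
have s1' : 0 < 1 - s by rewrite subr_gt0.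
apply: (@integral_disc_le x (fun t => t `^ (- s)) (fun t => t `^ (1 - s) / (1 - s))) => //.
- by move=> t; exact: powR_ge0.
- by move=> t t0; rewrite divr_ge0 ?powR_ge0// ltW.
- move=> t t0; apply: differentiable_continuous; apply/derivable1_diffP.
  by apply: (@ex_derive _ _ _ _ _ _ _ (is_derive1_powR _ t0)).
- move=> t t0; have ? := is_derive1_powR (1 - s) t0; apply: is_derive_eq.
  rewrite scaler0 add0r /GRing.scale/= mulrA mulVf ?gt_eqF// mul1r.
  by congr (_ `^ _); lra.
Qed.

(** The source of the logarithm in the final estimate: in [t = |y - x|^2] the integrand is the
    derivative of [s^-1 ln(1 + t^s / c)]. The shift [c] removes the divergence that [1 / t] has at
    0. *)
Lemma integral_disc_log x (s c b : R) : 0 < s -> 0 < c -> 0 < b ->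
  (\int[leb2]_(y in disc x b)
     (sqdist x y `^ (s - 1) / (sqdist x y `^ s + c))%:E <=
   (pi / s * ln (1 + b `^ s / c))%:E)%E.
Proof.
move=> s0 c0 b0; rewrite -mulrA.
have pos t : 0 < t `^ s + c by rewrite ltr_wpDl ?powR_ge0.
have pos1 t : 0 < 1 + t `^ s / c by rewrite ltr_pwDl ?divr_ge0 ?powR_ge0 ?(ltW c0).
have cp (a t : R) : 0 < t -> {for t, continuous (fun t : R => t `^ a)}.
  move=> t0; apply: differentiable_continuous; apply/derivable1_diffP.
  by apply: (@ex_derive _ _ _ _ _ _ _ (is_derive1_powR a t0)).
apply: (@integral_disc_le x (fun t => t `^ (s - 1) / (t `^ s + c))
   (fun t => s^-1 * ln (1 + t `^ s / c))) => //.
- apply: measurable_funM; first exact: measurable_powR.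
  apply: measurable_funV_ge0; first by move=> t; exact/ltW.
  by apply: measurable_funD => //; exact: measurable_powR.
- by move=> t; rewrite divr_ge0 ?powR_ge0// ltW.
- by move=> t t0; rewrite mulr_ge0 ?invr_ge0 ?(ltW s0)// ln_ge0// lerDl divr_ge0 ?powR_ge0 ?(ltW c0).
- move=> t t0; apply: cvgM; first exact: cp.
  apply: cvgV; first by rewrite gt_eqF.
  by apply: cvgD; [exact: cp|exact: cvg_cst].
- move=> t t0; have ? := is_derive1_powR s t0.
  have ? := is_derive1_ln (pos1 t).
  have d1 : is_derive t 1 (fun t => 1 + t `^ s / c) (s * t `^ (s - 1) / c).
    by apply: is_derive_eq; rewrite scaler0 !add0r mul1r /GRing.scale/= mulrC.
  have d2 := @is_derive1_comp _ (@ln R) (fun t => 1 + t `^ s / c) t _ _ (is_derive1_ln (pos1 t)) d1.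
  rewrite (_ : (fun t1 => _) = s^-1 \*: (@ln R \o (fun t => 1 + t `^ s / c)))//.
  apply: is_derive_eq; rewrite /GRing.scale/=.
  field; do 2 ?[apply/andP; split]; rewrite ?gt_eqF//.
Qed.

End radial.

(** * A smooth step function *)

Section psi.
Context {R : realType}.
Implicit Types (t : R) (n : nat).

(* The derivatives of [psi 0] are linear combinations of the [psi n]. *)
Definition psi n t : R := if 0 < t then t^-1 ^+ n * expR (- t^-1) else 0.

Lemma psi_ge0 n t : 0 <= psi n t.
Proof.
by rewrite /psi; case: ifPn => // t0; rewrite mulr_ge0 ?expR_ge0// exprn_ge0// invr_ge0 ltW.
Qed.

Lemma psi_gt0 n t : 0 < t -> 0 < psi n t.
Proof. by move=> t0; rewrite /psi t0 mulr_gt0 ?expR_gt0// exprn_gt0// invr_gt0. Qed.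

Lemma psi_eq0 n t : t <= 0 -> psi n t = 0.
Proof. by rewrite /psi leNgt => /negbTE ->. Qed.

(** The term of order [n + 1] of the exponential series gives [t^-(n+1) <= (n+1)! exp(1/t)] for
    [t > 0]. *)
Lemma psi_le n t : psi n t <= (n.+1)`!%:R * `|t|.
Proof.
rewrite /psi; case: ifPn => [t0|_]; last by rewrite mulr_ge0.
have ti : 0 < t^-1 by rewrite invr_gt0.
have := expR_ge1Dxn n (ltW ti) => h.
have {}h : t^-1 ^+ n.+1 / (n.+1)`!%:R <= expR t^-1.
  by apply: le_trans h; rewrite lerDr.
rewrite expRN ler_pdivrMr ?expR_gt0// gtr0_norm//.
move: h; rewrite ler_pdivrMr ?ltr0n ?fact_gt0// mulrC exprS => h.
rewrite mulrAC mulrC -ler_pdivrMl//.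
Qed.

Lemma is_derive_psi n t : is_derive t 1 (psi n) (- n%:R * psi n.+1 t + psi n.+2 t).
Proof.
have [t0|t0|->] := ltgtP t 0.
- rewrite !psi_eq0 ?ltW// mulr0 addr0.
  apply: (@near_eq_is_derive _ _ _ (cst 0)).
  near=> s; rewrite psi_eq0//=; apply/ltW; near: s; exact: lt_nbhsl.
- apply: (@near_eq_is_derive _ _ _ (fun s : R => s^-1 ^+ n * expR (- s^-1))).
    near=> s; rewrite /psi ifT//; near: s; exact: lt_nbhsr.
  have tn0 : t != 0 by rewrite gt_eqF.
  have d1 : is_derive t 1 (fun s : R => s^-1) (- t ^- 2).
    apply: is_derive_eq (@is_deriveV _ id t 1 1 tn0 (is_derive_id t 1)) _.
    by rewrite /GRing.scale/= mulr1.
  have d2 : is_derive t 1 (fun s : R => expR (- s^-1)) (expR (- t^-1) * t ^- 2).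
    have d3 : is_derive t 1 (fun s : R => - s^-1) (t ^- 2).
      by apply: is_derive_eq; rewrite opprK.
    by have := @is_derive1_comp _ expR (fun s => - s^-1) t _ _ _ d3; apply.
  have d3 := is_deriveX n d1.
  have d4 := is_deriveM d3 d2.
  rewrite mulrfctE exprfctE in d4.
  apply: (is_derive_eq d4).
  rewrite /GRing.scale/= /psi t0 -exprVn.
  case: n {d3 d4} => [|m] /=; first by rewrite !expr0; ring.
  by rewrite !exprS; ring.
- rewrite !psi_eq0 // mulr0 addr0.
  have L : h^-1 *: ((psi n \o shift 0) (h *: 1) - psi n 0) @[h --> (0:R)^'] --> (0:R).
    apply: (@squeeze_cvgr _ _ _ _ (cst 0) (fun h => (n.+2)`!%:R * `|h|)).
    + near=> h.
      have h0 : h != 0 by near: h; exact: nbhs_dnbhs_neq.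
      rewrite /= (psi_eq0 n (lexx 0)) subr0 addr0 /GRing.scale/= mulr1.
      (* At 0 the difference quotient is the next function of the family, which [psi_le] squeezes to
         0. *)
      have -> : h^-1 * psi n h = psi n.+1 h.
        rewrite /psi; case: ifPn; rewrite ?mulr0//.
        by rewrite exprS mulrA.
      by rewrite psi_ge0 psi_le.
    + exact: cvg_cst.
    + rewrite -[X in _ --> X](mulr0 (n.+2)`!%:R); apply: cvgM; first exact: cvg_cst.
      rewrite -[X in _ --> X](normr0 R); apply: cvg_norm.
      by apply: cvg_within_filter; exact: cvg_id.
  apply: DeriveDef; first by apply/cvg_ex; exists 0.
  by rewrite /derive; apply/cvg_lim.
Unshelve. all: by end_near. Qed.

Lemma continuous_psi n : continuous (psi n).
Proof.
move=> t; apply: differentiable_continuous; apply/derivable1_diffP.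
by apply: (@ex_derive _ _ _ _ _ _ _ (is_derive_psi n t)).
Qed.

End psi.

Section step.
Context {R : realType}.
Implicit Types t : R.

Definition step t : R := psi 0 (t - 1) / (psi 0 (t - 1) + psi 0 (2 - t)).

(** The quotient rule after cancellation, the derivative of [psi 0] being [psi 2]. All remaining
    terms are nonnegative, which later makes the bump [kap] nonnegative. *)
Definition dstep t : R :=
  (psi 2 (t - 1) * psi 0 (2 - t) + psi 0 (t - 1) * psi 2 (2 - t)) /
  (psi 0 (t - 1) + psi 0 (2 - t)) ^+ 2.

Lemma psi_partition_gt0 t : 0 < psi 0 (t - 1) + psi 0 (2 - t).
Proof.
have [t1|t1] := ltP 1 t.
  by rewrite ltr_pwDl ?psi_ge0// psi_gt0// subr_gt0.
by rewrite ltr_wpDl ?psi_ge0// psi_gt0//; lra.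
Qed.

Lemma step_eq0 t : t <= 1 -> step t = 0.
Proof. by move=> t1; rewrite /step psi_eq0 ?mul0r// subr_le0. Qed.

Lemma step_eq1 t : 2 <= t -> step t = 1.
Proof.
move=> t2; have := psi_partition_gt0 t; rewrite /step (@psi_eq0 _ _ (2 - t)) ?subr_le0//.
by rewrite addr0 => h; rewrite divff ?gt_eqF.
Qed.

Lemma step_ge0 t : 0 <= step t.
Proof. by rewrite divr_ge0 ?psi_ge0// ltW// psi_partition_gt0. Qed.

Lemma step_le1 t : step t <= 1.
Proof. by rewrite ler_pdivrMr ?psi_partition_gt0// mul1r lerDl psi_ge0. Qed.

Lemma dstep_ge0 t : 0 <= dstep t.
Proof. by rewrite divr_ge0 ?sqr_ge0// addr_ge0// mulr_ge0 ?psi_ge0. Qed.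

Lemma dstep_eq0 t : t <= 1 \/ 2 <= t -> dstep t = 0.
Proof.
case=> ht; rewrite /dstep.
  by rewrite !(@psi_eq0 _ _ (t - 1)) ?subr_le0// !mul0r addr0 mul0r.
by rewrite !(@psi_eq0 _ _ (2 - t)) ?subr_le0// !mulr0 addr0 mul0r.
Qed.

Lemma is_derive_step t : is_derive t 1 step (dstep t).
Proof.
have d1 : is_derive t 1 (fun s : R => psi 0 (s - 1)) (psi 2 (t - 1)).
  have d : is_derive t 1 (fun s : R => s - 1) 1 by apply: is_derive_eq; rewrite subr0.
  apply: is_derive_eq (@is_derive1_comp _ (psi 0) (fun s => s - 1) _ _ _ (is_derive_psi 0 (t - 1)) d) _.
  by rewrite oppr0 mul0r add0r mulr1.
have d2 : is_derive t 1 (fun s : R => psi 0 (2 - s)) (- psi 2 (2 - t)).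
  have d : is_derive t 1 (fun s : R => 2 - s) (-1).
    by apply: is_derive_eq; rewrite add0r mul1r.
  apply: is_derive_eq (@is_derive1_comp _ (psi 0) (fun s => 2 - s) _ _ _ (is_derive_psi 0 (2 - t)) d) _.
  by rewrite oppr0 mul0r add0r mulrN1.
have d3 := is_deriveD d1 d2.
rewrite addrfctE in d3.
have d4 := is_deriveV _ d3.
have d5 := is_deriveM d1 (d4 _).
rewrite mulrfctE in d5.
apply: is_derive_eq (d5 _) _; first by rewrite gt_eqF// psi_partition_gt0.
rewrite /GRing.scale/= /dstep.
have h := psi_partition_gt0 t.
by field; rewrite gt_eqF.
Qed.

Lemma continuous_dstep : continuous dstep.
Proof.
have c1 n : continuous (fun s : R => psi n (s - 1)).
  move=> t; apply: (@continuous_comp _ _ _ (fun s : R => s - 1) (psi n)); last exact: continuous_psi.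
  by apply: cvgB; [exact: cvg_id|exact: cvg_cst].
have c2 n : continuous (fun s : R => psi n (2 - s)).
  move=> t; apply: (@continuous_comp _ _ _ (fun s : R => 2 - s) (psi n)); last exact: continuous_psi.
  by apply: cvgB; [exact: cvg_cst|exact: cvg_id].
move=> t; apply: cvgM.
  by apply: cvgD; apply: cvgM; (exact: c1 || exact: c2).
apply: cvgV; first by rewrite sqrf_eq0 gt_eqF// psi_partition_gt0.
by rewrite expr2; apply: cvgM; apply: cvgD; (exact: c1 || exact: c2).
Qed.

Lemma measurable_dstep : measurable_fun [set: R] dstep.
Proof. exact: continuous_measurable_fun continuous_dstep. Qed.

Lemma dstep_bounded : exists2 K : R, 0 <= K & forall t, dstep t <= K.
Proof.
have [c _ cP] := @EVT_max R dstep 1 2 (ler1n _ _) (continuous_subspaceT continuous_dstep).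
exists (dstep c) => [|t]; first exact: dstep_ge0.
have [t1|t1] := leP t 1; first by rewrite dstep_eq0 ?dstep_ge0//; left.
have [t2|t2] := leP 2 t; first by rewrite (@dstep_eq0 t) ?dstep_ge0//; right.
by apply: cP; rewrite in_itv/= !ltW.
Qed.

Lemma is_derive_step_scale c t : is_derive t 1 (fun s : R => step (s / c)) (dstep (t / c) / c).
Proof.
have d : is_derive t 1 (fun s : R => s / c) c^-1.
  by apply: is_derive_eq; rewrite scaler0 add0r /GRing.scale/= mulr1.
exact: (@is_derive1_comp _ step (fun s => s / c) _ _ _ (is_derive_step _) d).
Qed.

Lemma integral_dstep c : 0 < c ->
  (\int[lebesgue_measure]_(t in `[0%R, +oo[) (dstep (t / c) / c)%:E = 1)%E.
Proof.
move=> c0.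
transitivity (\int[lebesgue_measure]_(t in `[c, (2 * c)%R]) (dstep (t / c) / c)%:E)%E.
  rewrite [LHS]integral_mkcond [RHS]integral_mkcond; apply: eq_integral => t _.
  rewrite !patchE; case: ifPn; case: ifPn => //; rewrite ?notin_setE ?inE/= !in_itv/= ?andbT.
    move=> /negP; rewrite negb_and -!ltNge => h _.
    rewrite dstep_eq0 ?mul0r//; case/orP: h => /ltW h; [left|right].
      by rewrite ler_pdivrMr// mul1r.
    by rewrite ler_pdivlMr.
  by move=> /andP[t1 _] /negP; rewrite (le_trans (ltW c0) t1).
have cd : continuous (fun t : R => dstep (t / c) / c).
  move=> t; apply: cvgM; last exact: cvg_cst.
  apply: (@continuous_comp _ _ _ (fun s : R => s / c) dstep); last exact: continuous_dstep.
  by apply: cvgM; [exact: cvg_id|exact: cvg_cst].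
rewrite (@continuous_FTC2 _ (fun t : R => dstep (t / c) / c) (fun t : R => step (t / c))).
- by rewrite step_eq1 ?step_eq0 ?mulfK ?divff ?gt_eqF// sube0.
- by rewrite ltr_pMl// ltr1n.
- exact: continuous_subspaceT cd.
- have cs : continuous (fun t : R => step (t / c)).
    move=> t; apply: differentiable_continuous; apply/derivable1_diffP.
    by apply: (@ex_derive _ _ _ _ _ _ _ (is_derive_step_scale c t)).
  split.
  + by move=> t _; apply: (@ex_derive _ _ _ _ _ _ _ (is_derive_step_scale c t)).
  + exact/cvg_at_right_filter/cs.
  + exact/cvg_at_left_filter/cs.
- by move=> t _; rewrite derive1E; have := is_derive_step_scale c t => ?; apply: derive_val.
Qed.

End step.

(** * Test functions *)

Section chain.
Context {R : realType} {V : normedModType R}.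
Implicit Types (f : V -> R) (x v : V).

Lemma line_quotientE f x v :
  (fun h : R => h^-1 *: ((f \o shift x) (h *: v) - f x)) =
  (fun h : R => h^-1 *: (((fun h : R => f (h *: v + x)) \o shift 0) (h *: 1) -
                     f (0 *: v + x))).
Proof. by apply/funext => h /=; rewrite scale0r add0r addr0 /GRing.scale/= mulr1. Qed.

(** A directional derivative is a one-variable derivative along [h *: v + x], so the one-variable
    chain rule applies. *)
Lemma is_derive_comp (g : R -> R) f x v l d :
  is_derive (f x) 1 g l -> is_derive x v f d -> is_derive x v (g \o f) (l * d).
Proof.
move=> dg [cf fE].
have df : is_derive (0 : R) 1 (fun h : R => f (h *: v + x)) d.
  split; rewrite /derivable /derive -line_quotientE //.
have := @is_derive1_comp _ g (fun h : R => f (h *: v + x)) 0 l d.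
rewrite scale0r add0r => /(_ dg df) [c1 c1E].
by split; rewrite /derivable /derive line_quotientE /=.
Qed.

End chain.

Section Ck.
Context {R : realType}.
Implicit Types (phi chi : R * R -> R) (x y : R * R) (k : nat).

Lemma Ck_continuous k phi : Ck k phi -> continuous phi.
Proof. by case: k => [|k] // []. Qed.

Lemma Ck_le k phi : Ck k.+1 phi -> Ck k phi.
Proof.
elim: k phi => [phi|k IH phi]; first exact: Ck_continuous.
by case=> c d /IH h1 /IH h2; split.
Qed.

(** Extensionality replaces the derivatives by the explicit functions [d1] and [d2], so that
    inductions on [k] can proceed on formulas. *)
Lemma CkS k phi (d1 d2 : R * R -> R) : continuous phi ->
  (forall x, is_derive x e1 phi (d1 x)) -> (forall x, is_derive x e2 phi (d2 x)) ->
  Ck k d1 -> Ck k d2 -> Ck k.+1 phi.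
Proof.
move=> c h1 h2 C1 C2.
have E1 : 'D_e1 phi = d1.
  by apply/funext => x; exact: (@derive_val _ _ _ _ _ _ _ (h1 x)).
have E2 : 'D_e2 phi = d2.
  by apply/funext => x; exact: (@derive_val _ _ _ _ _ _ _ (h2 x)).
split; rewrite ?E1 ?E2//.
Qed.

Lemma Ck_is_derive1 k phi x : Ck k.+1 phi -> is_derive x e1 phi ('D_e1 phi x).
Proof. by case=> _ d _ _; apply: derivableP; case: (d x). Qed.

Lemma Ck_is_derive2 k phi x : Ck k.+1 phi -> is_derive x e2 phi ('D_e2 phi x).
Proof. by case=> _ d _ _; apply: derivableP; case: (d x). Qed.

Lemma Ck_cst k (c : R) : Ck k (fun=> c).
Proof.
elim: k c => [|k IH] c; first by move=> x; exact: cvg_cst.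
by apply: (@CkS _ _ (fun=> 0) (fun=> 0)) => //; move=> x; exact: cvg_cst.
Qed.

Lemma is_derive_fst x (v : R * R) : is_derive x v (fst : R * R -> R) v.1.
Proof.
have E : (fun h : R => h^-1 *: (((fst : R * R -> R) \o shift x) (h *: v) - x.1)) =
    (fun h : R => h^-1 *: ((id \o shift x.1) (h *: v.1) - id x.1)) by [].
have [d1 d2] := is_derive_id x.1 v.1.
by split; rewrite /derivable /derive E.
Qed.

Lemma is_derive_snd x (v : R * R) : is_derive x v (snd : R * R -> R) v.2.
Proof.
have E : (fun h : R => h^-1 *: (((snd : R * R -> R) \o shift x) (h *: v) - x.2)) =
    (fun h : R => h^-1 *: ((id \o shift x.2) (h *: v.2) - id x.2)) by [].
have [d1 d2] := is_derive_id x.2 v.2.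
by split; rewrite /derivable /derive E.
Qed.

Lemma Ck_fst k : Ck k (fst : R * R -> R).
Proof.
case: k => [|k]; first by move=> x; exact: cvg_fst.
apply: (@CkS _ _ (fun=> 1) (fun=> 0)); try exact: Ck_cst.
- by move=> x; exact: cvg_fst.
- by move=> x; exact: is_derive_fst.
- by move=> x; exact: is_derive_fst.
Qed.

Lemma Ck_snd k : Ck k (snd : R * R -> R).
Proof.
case: k => [|k]; first by move=> x; exact: cvg_snd.
apply: (@CkS _ _ (fun=> 0) (fun=> 1)); try exact: Ck_cst.
- by move=> x; exact: cvg_snd.
- by move=> x; exact: is_derive_snd.
- by move=> x; exact: is_derive_snd.
Qed.

Lemma CkD k phi chi : Ck k phi -> Ck k chi -> Ck k (fun x => phi x + chi x).
Proof.
elim: k phi chi => [phi chi c1 c2 x|k IH phi chi p1 p2]; first by apply: cvgD; [exact: c1|exact: c2].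
apply: (@CkS _ _ (fun x => 'D_e1 phi x + 'D_e1 chi x) (fun x => 'D_e2 phi x + 'D_e2 chi x)).
- by move=> x; apply: cvgD; apply: Ck_continuous; eassumption.
- by move=> x; apply: is_deriveD; apply: Ck_is_derive1; eassumption.
- by move=> x; apply: is_deriveD; apply: Ck_is_derive2; eassumption.
- by case: p1 p2 => _ _ ? _ [] _ _ ? _; exact: IH.
- by case: p1 p2 => _ _ _ ? [] _ _ _ ?; exact: IH.
Qed.

Lemma CkM k phi chi : Ck k phi -> Ck k chi -> Ck k (fun x => phi x * chi x).
Proof.
elim: k phi chi => [phi chi c1 c2 x|k IH phi chi p1 p2]; first by apply: cvgM; [exact: c1|exact: c2].
apply: (@CkS _ _ (fun x => phi x * 'D_e1 chi x + chi x * 'D_e1 phi x)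
   (fun x => phi x * 'D_e2 chi x + chi x * 'D_e2 phi x)).
- by move=> x; apply: cvgM; apply: Ck_continuous; eassumption.
- by move=> x; apply: is_deriveM; apply: Ck_is_derive1; eassumption.
- by move=> x; apply: is_deriveM; apply: Ck_is_derive2; eassumption.
- by apply: CkD; apply: IH; try exact: Ck_le; case: p1 => _ _ ? _; case: p2 => _ _ ? _.
- by apply: CkD; apply: IH; try exact: Ck_le; case: p1 => _ _ _ ?; case: p2 => _ _ _ ?.
Qed.

(** The induction ranges over all [n] at once, because differentiating [psi n] brings in [psi n.+1]
    and [psi n.+2]. *)
Lemma Ck_psi k n phi : Ck k phi -> Ck k (fun x => psi n (phi x)).
Proof.
elim: k n phi => [n phi c x|k IH n phi p].
  by apply: (@continuous_comp _ _ _ phi (psi n)); [exact: c|exact: continuous_psi].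
pose g x := - n%:R * psi n.+1 (phi x) + psi n.+2 (phi x).
apply: (@CkS _ _ (fun x => g x * 'D_e1 phi x) (fun x => g x * 'D_e2 phi x)).
- move=> x; apply: (@continuous_comp _ _ _ phi (psi n)); last exact: continuous_psi.
  exact: Ck_continuous p _.
- move=> x; apply: (is_derive_comp (is_derive_psi n (phi x))); exact: Ck_is_derive1 p.
- move=> x; apply: (is_derive_comp (is_derive_psi n (phi x))); exact: Ck_is_derive2 p.
- apply: CkM; last by case: p.
  by apply: CkD; [apply: CkM; [exact: Ck_cst|]|]; apply/IH/Ck_le.
- apply: CkM; last by case: p.
  by apply: CkD; [apply: CkM; [exact: Ck_cst|]|]; apply/IH/Ck_le.
Qed.

Lemma CkV k phi : (forall x, phi x != 0) -> Ck k phi -> Ck k (fun x => (phi x)^-1).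
Proof.
move=> phi0; elim: k => [c x|k IH p]; first by apply: cvgV => //; exact: c.
have dV x : is_derive (phi x) 1 (fun t : R => t^-1) (- (phi x) ^- 2).
  apply: is_derive_eq (@is_deriveV _ id (phi x) 1 1 (phi0 x) (is_derive_id _ _)) _.
  by rewrite /GRing.scale/= mulr1.
pose g x := - 1 * ((phi x)^-1 * (phi x)^-1).
have gE x : - (phi x) ^- 2 = g x by rewrite /g mulN1r -expr2 exprVn.
apply: (@CkS _ _ (fun x => g x * 'D_e1 phi x) (fun x => g x * 'D_e2 phi x)).
- move=> x; apply: cvgV => //; exact: Ck_continuous p _.
- move=> x; rewrite -gE; apply: (is_derive_comp (dV x)); exact: Ck_is_derive1 p.
- move=> x; rewrite -gE; apply: (is_derive_comp (dV x)); exact: Ck_is_derive2 p.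
- apply: CkM; last by case: p.
  by apply: CkM; [exact: Ck_cst|]; apply: CkM; apply/IH/Ck_le.
- apply: CkM; last by case: p.
  by apply: CkM; [exact: Ck_cst|]; apply: CkM; apply/IH/Ck_le.
Qed.

Lemma Ck_step k phi : Ck k phi -> Ck k (fun x => step (phi x)).
Proof.
move=> p; have h1 : Ck k (fun x => psi 0 (phi x - 1)).
  by apply: Ck_psi; apply: CkD => //; exact: Ck_cst.
apply: CkM => //; apply: CkV; first by move=> x; rewrite gt_eqF// psi_partition_gt0.
apply: CkD => //; apply: Ck_psi.
rewrite (_ : (fun x => _) = (fun x => 2 + -1 * phi x)); last by apply/funext => x; rewrite mulN1r.
by apply: CkD; [exact: Ck_cst|apply: CkM => //; exact: Ck_cst].
Qed.

Lemma Ck_sqdist k x : Ck k (sqdist x).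
Proof.
rewrite /sqdist (_ : (fun y => _) = (fun y => (y.1 + - x.1) * (y.1 + - x.1) + (y.2 + - x.2) * (y.2 + - x.2))).
  apply: CkD; apply: CkM; apply: CkD; by [exact: Ck_fst|exact: Ck_snd|exact: Ck_cst].
by apply/funext => y; rewrite !expr2.
Qed.

End Ck.

(** * The truncated Newtonian field *)

Section field.
Context {R : realType}.
Implicit Types (x y : plane R) (a b c t : R).

Definition kernel_profile a b t : R := (step (t / a) - step (t / b)) / (2 * pi * t).

(* A smooth truncation, supported in [a <= |y - x|^2 <= 2 b], of the field
   [(y - x) / (2 pi |y - x|^2)], whose divergence is the Dirac mass at [x]. *)
Definition field1 a b x y : R := (y.1 - x.1) * kernel_profile a b (sqdist x y).
Definition field2 a b x y : R := (y.2 - x.2) * kernel_profile a b (sqdist x y).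

(** The bump [k_c] of the overview: away from [x], it is the divergence of [(y - x) step(|y - x|^2 /
    c) / (2 pi |y - x|^2)]. *)
Definition kap c x y : R := dstep (sqdist x y / c) / (pi * c).

Lemma sqdistC x y : sqdist x y = sqdist y x.
Proof. by rewrite /sqdist -(sqrrN (y.1 - _)) -(sqrrN (y.2 - _)) !opprB. Qed.

Lemma Ck_profile k a b x : 0 < a -> a < b ->
  Ck k (fun y : R * R => kernel_profile a b (sqdist x y)).
Proof.
move=> a0 ab; have b0 : 0 < b := lt_trans a0 ab.
(* A smooth positive substitute for the denominator, which vanishes at [x]. It equals
   [2 pi |y - x|^2] where [|y - x|^2 >= a]; elsewhere the numerator is 0, so the quotient is
   unchanged. *)
pose d (y : R * R) := 2 * pi * (sqdist x y + psi 0 (1 + - 1 * (sqdist x y / a))).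
have d0 y : 0 < d y.
  rewrite /d mulr_gt0 ?mulr_gt0 ?pi_gt0//.
  have [s0|s0] := ltP 0 (sqdist x y); first by rewrite ltr_pwDl ?psi_ge0.
  have -> : sqdist x y = 0 by apply/eqP; rewrite eq_le s0 sqdist_ge0.
  by rewrite mul0r mulr0 addr0 add0r psi_gt0.
rewrite (_ : (fun y => _) = (fun y => (step (sqdist x y / a) + - 1 * step (sqdist x y / b)) * (d y)^-1)).
  have Cs c : Ck k (fun y : R * R => sqdist x y / c) by apply: CkM; [exact: Ck_sqdist|exact: Ck_cst].
  apply: CkM.
    by apply: CkD; [|apply: CkM; [exact: Ck_cst|]]; exact: Ck_step.
  apply: CkV => [y|]; first by rewrite gt_eqF.
  apply: CkM; [exact: Ck_cst|apply: CkD; [exact: Ck_sqdist|]].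
  by apply: Ck_psi; apply: CkD; [exact: Ck_cst|apply: CkM => //; exact: Ck_cst].
apply/funext => y; rewrite /kernel_profile mulN1r.
have [sa|sa] := leP (sqdist x y) a.
  by rewrite !step_eq0 ?subrr ?mul0r// ler_pdivrMr// mul1r// (le_trans sa)// ltW.
rewrite /d psi_eq0 ?addr0// mulN1r subr_le0 ler_pdivlMr// mul1r ltW//.
Qed.

Lemma profile_eq0 a b t : 0 < a -> a < b -> t <= a \/ 2 * b <= t -> kernel_profile a b t = 0.
Proof.
move=> a0 ab; have b0 : 0 < b := lt_trans a0 ab.
rewrite /kernel_profile; case=> ht.
  by rewrite !step_eq0 ?subrr ?mul0r// ler_pdivrMr// mul1r// (le_trans ht)// ltW.
by rewrite !step_eq1 ?subrr ?mul0r// ler_pdivlMr// (le_trans _ ht)// ler_pM2l// ltW.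
Qed.

Lemma profile_bound a b t : 0 < a -> a < b -> `|kernel_profile a b t| <= (2 * pi * `|t|)^-1.
Proof.
move=> a0 ab; rewrite /kernel_profile normrM normfV (_ : `|2 * pi * t| = 2 * pi * `|t|); last first.
  by rewrite !normrM (ger0_norm (pi_ge0 R)) (ger0_norm (ler0n _ 2)).
rewrite ler_piMl ?invr_ge0 ?mulr_ge0 ?pi_ge0//.
have := step_ge0 (t / a); have := step_le1 (t / a).
have := step_ge0 (t / b); have := step_le1 (t / b).
by move=> *; rewrite ler_norml; apply/andP; split; lra.
Qed.

Definition dprofile a b t : R :=
  (dstep (t / a) / a - dstep (t / b) / b) / (2 * pi * t) - kernel_profile a b t / t.

Lemma dprofile_eq0 a b t : 0 < a -> a < b -> t <= a \/ 2 * b <= t -> dprofile a b t = 0.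
Proof.
move=> a0 ab ht; have b0 : 0 < b := lt_trans a0 ab.
rewrite /dprofile profile_eq0// !dstep_eq0 ?mul0r ?subrr ?mul0r ?subrr//.
  by case: ht => h; [left; rewrite ler_pdivrMr// mul1r (le_trans h)// ltW|right; rewrite ler_pdivlMr].
case: ht => h; [left; rewrite ler_pdivrMr// mul1r//|right; rewrite ler_pdivlMr//].
by rewrite (le_trans _ h)// ler_pM2l// ltW.
Qed.

(** The left side is the divergence in the plane of the radial field [(y - x) k(|y - x|^2)]. For
    [t > a] this is algebra; for [t <= a] all terms vanish, which disposes of the division by
    [t]. *)
Lemma dprofileE a b t : 0 < a -> a < b ->
  2 * kernel_profile a b t + 2 * t * dprofile a b t = (dstep (t / a) / a - dstep (t / b) / b) / pi.
Proof.
move=> a0 ab; have b0 : 0 < b := lt_trans a0 ab.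
have [ta|ta] := leP t a; last first.
  have tp := lt_trans a0 ta.
  rewrite /dprofile; move: (@pi R) (pi_gt0 R) (kernel_profile _ _ _) => P P0 k.
  by field; rewrite !gt_eqF.
rewrite profile_eq0 ?dprofile_eq0 ?mulr0 ?addr0//; try by left.
by rewrite !dstep_eq0 ?mul0r ?subrr ?mul0r//; left; rewrite ler_pdivrMr// mul1r// (le_trans ta)// ltW.
Qed.

Lemma is_derive_profile a b t : 0 < a -> a < b -> 0 <= t ->
  is_derive t 1 (kernel_profile a b) (dprofile a b t).
Proof.
move=> a0 ab t0; have b0 : 0 < b := lt_trans a0 ab.
(* Below [a] the profile is locally zero, so the quotient rule is applied only where [t] is
   positive. *)
have [ta|at_] := ltP t a.
  rewrite dprofile_eq0//; last by left; exact: ltW.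
  apply: (@near_eq_is_derive _ _ _ (cst 0)).
  near=> s; rewrite profile_eq0//; left; apply/ltW; near: s; exact: lt_nbhsl.
have tp : 0 < t := lt_le_trans a0 at_.
have dl : is_derive t 1 (fun s : R => 2 * pi * s) (2 * pi).
  by apply: is_derive_eq; rewrite /GRing.scale/= mulr1.
have tn0 : 2 * pi * t != 0 by rewrite !mulf_neq0// gt_eqF// pi_gt0.
have d1 := is_deriveD (is_derive_step_scale a t) (is_deriveN (is_derive_step_scale b t)).
have d2 := is_deriveM d1 (is_deriveV tn0 dl).
rewrite mulrfctE addrfctE opprfctE in d2.
apply: is_derive_eq d2 _.
rewrite /dprofile /kernel_profile /GRing.scale/=.
move: (@pi R) (pi_gt0 R) => P P0; field.
by rewrite !gt_eqF.
Unshelve. all: by end_near. Qed.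

Lemma is_derive_sqdist x y (v : R * R) :
  is_derive (y : R * R) v (sqdist x : R * R -> R) (2 * (y.1 - x.1) * v.1 + 2 * (y.2 - x.2) * v.2).
Proof.
have d1 : is_derive (y : R * R) v (fun z => z.1 - x.1) v.1.
  apply: is_derive_eq (is_deriveD (is_derive_fst (y : R * R) v) (is_deriveN (is_derive_cst x.1 (y : R * R) v))) _.
  by rewrite oppr0 addr0.
have d2 : is_derive (y : R * R) v (fun z => z.2 - x.2) v.2.
  apply: is_derive_eq (is_deriveD (is_derive_snd (y : R * R) v) (is_deriveN (is_derive_cst x.2 (y : R * R) v))) _.
  by rewrite oppr0 addr0.
have d3 := is_deriveD (is_deriveX 2 d1) (is_deriveX 2 d2).
rewrite addrfctE !exprfctE in d3.
by apply: is_derive_eq d3 _; rewrite /GRing.scale/= !expr1.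
Qed.

(** With [w] equal to a coordinate of [y - x], this is the partial derivative of that component of
    the field in its own direction; one formula serves both coordinates. *)
Definition dfield (w : R) a b x y : R :=
  kernel_profile a b (sqdist x y) + 2 * w ^+ 2 * dprofile a b (sqdist x y).

Lemma derive_field1 a b x : 0 < a -> a < b ->
  'D_e1 (field1 a b x : R * R -> R) = (fun y => dfield (y.1 - x.1) a b x y).
Proof.
move=> a0 ab; apply/funext => y.
have dg := is_derive_profile a0 ab (sqdist_ge0 x y).
have d1 : is_derive y e1 (fun z : R * R => z.1 - x.1) 1.
  apply: is_derive_eq (is_deriveD (is_derive_fst (y : R * R) e1) (is_deriveN (is_derive_cst x.1 (y : R * R) e1))) _.
  by rewrite oppr0 addr0.
have h1 := is_deriveM d1 (is_derive_comp dg (is_derive_sqdist x y e1)).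
rewrite !mulrfctE in h1.
have E1 : 'D_e1 (field1 a b x : R * R -> R) y = _ := @derive_val _ _ _ _ _ _ _ h1.
by rewrite E1 /dfield /GRing.scale /e1/=; ring.
Qed.

Lemma derive_field2 a b x : 0 < a -> a < b ->
  'D_e2 (field2 a b x : R * R -> R) = (fun y => dfield (y.2 - x.2) a b x y).
Proof.
move=> a0 ab; apply/funext => y.
have dg := is_derive_profile a0 ab (sqdist_ge0 x y).
have d1 : is_derive y e2 (fun z : R * R => z.2 - x.2) 1.
  apply: is_derive_eq (is_deriveD (is_derive_snd (y : R * R) e2) (is_deriveN (is_derive_cst x.2 (y : R * R) e2))) _.
  by rewrite oppr0 addr0.
have h1 := is_deriveM d1 (is_derive_comp dg (is_derive_sqdist x y e2)).
rewrite !mulrfctE in h1.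
have E1 : 'D_e2 (field2 a b x : R * R -> R) y = _ := @derive_val _ _ _ _ _ _ _ h1.
by rewrite E1 /dfield /GRing.scale /e2/=; ring.
Qed.

(** The two squares [w^2] add up to [sqdist x y], which turns the sum into the left side of
    [dprofileE]. *)
Lemma divergence_field a b x y : 0 < a -> a < b ->
  dfield (y.1 - x.1) a b x y + dfield (y.2 - x.2) a b x y = kap a x y - kap b x y.
Proof.
move=> a0 ab; have b0 : 0 < b := lt_trans a0 ab.
have -> : kap a x y - kap b x y = (dstep (sqdist x y / a) / a - dstep (sqdist x y / b) / b) / pi.
  by rewrite /kap; move: (@pi R) (pi_gt0 R) => P P0; field; rewrite !gt_eqF.
rewrite -dprofileE// /dfield; set k := kernel_profile _ _ _; set k' := dprofile _ _ _.
by rewrite /sqdist; ring.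
Qed.

End field.

(** * Support and size of the field, mass of its divergence *)

Section field_estimates.
Context {R : realType}.
Implicit Types (x y : plane R) (a b c t : R).

Lemma compact_box (x : R * R) (r : R) :
  compact (`[(x.1 - r), (x.1 + r)] `*` `[(x.2 - r), (x.2 + r)] : set (R * R)).
Proof. by apply: compact_setX; exact: segment_compact. Qed.

Lemma disc_sub_box x (r : R) : 0 <= r ->
  disc x (r ^+ 2) `<=` `[(x.1 - r), (x.1 + r)] `*` `[(x.2 - r), (x.2 + r)].
Proof.
move=> r0 y; rewrite /disc /= /sqdist => h.
suff: `|y.1 - x.1| <= r /\ `|y.2 - x.2| <= r.
  by rewrite !in_itv/= -!ler_distl => -[-> ->].
by split; rewrite -ler_sqr ?nnegrE// real_normK ?num_real//;
  have := sqr_ge0 (y.1 - x.1); have := sqr_ge0 (y.2 - x.2); lra.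
Qed.

Lemma compact_support (phi : R * R -> R) x b : (forall y, b <= sqdist x y -> phi y = 0) ->
  compact (closure [set y | phi y != 0]).
Proof.
(* The square of [|b| + 1] is at least [b], so the box of this half-width contains every point where
   [phi] is nonzero. *)
move=> h; pose r := `|b| + 1.
have Kc := @compact_box x r.
apply: (subclosed_compact _ Kc); first exact: closed_closure.
have Kcl : closed (`[(x.1 - r), (x.1 + r)] `*` `[(x.2 - r), (x.2 + r)] : set (R * R)).
  by apply: compact_closed => //; exact: norm_hausdorff.
rewrite [X in _ `<=` X]((closure_id _).1 Kcl); apply: closure_subset => y /= phi0.
apply: (@disc_sub_box x r); first by rewrite addr_ge0.
rewrite /disc /= ltNge; apply/negP => rs; move/eqP: phi0; apply; apply: h.
apply: le_trans rs; rewrite /r; have := ler_norm b; have := normr_ge0 b; nra.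
Qed.

Lemma test_function_field1 a b x : 0 < a -> a < b -> test_function (field1 a b x : R * R -> R).
Proof.
move=> a0 ab; split=> [k|].
  apply: CkM; last exact: Ck_profile.
  by apply: CkD; [exact: Ck_fst|exact: Ck_cst].
apply: (@compact_support _ x (2 * b)) => y h.
by rewrite /field1 profile_eq0 ?mulr0//; right.
Qed.

Lemma test_function_field2 a b x : 0 < a -> a < b -> test_function (field2 a b x : R * R -> R).
Proof.
move=> a0 ab; split=> [k|].
  apply: CkM; last exact: Ck_profile.
  by apply: CkD; [exact: Ck_snd|exact: Ck_cst].
apply: (@compact_support _ x (2 * b)) => y h.
by rewrite /field2 profile_eq0 ?mulr0//; right.
Qed.

Lemma enorm_ge0 (v : R * R) : 0 <= enorm v.
Proof. exact: sqrtr_ge0. Qed.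

(** Cauchy-Schwarz against [y - x], then [profile_bound]. The right side is free of [a] and [b], so
    it can dominate the integrands while [a] tends to 0. *)
Lemma field_bound a b x y (v : R * R) : 0 < a -> a < b ->
  `|v.1 * field1 a b x y + v.2 * field2 a b x y| <=
  (2 * pi)^-1 * (enorm v / Num.sqrt (sqdist x y)).
Proof.
move=> a0 ab; rewrite /field1 /field2.
set z1 := y.1 - x.1; set z2 := y.2 - x.2; set k := kernel_profile _ _ _.
have rho0 := sqdist_ge0 x y.
have kb : `|k| <= (2 * pi * sqdist x y)^-1.
  by rewrite -[X in _ * X](ger0_norm rho0); exact: profile_bound.
have [r0|r0] := eqVneq (sqdist x y) 0.
  rewrite /k r0 profile_eq0// ?mulr0 ?addr0 ?normr0; last by left; exact: ltW.
  by rewrite mulr_ge0 ?invr_ge0 ?mulr_ge0 ?pi_ge0 ?enorm_ge0 ?sqrtr_ge0.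
have rp : 0 < sqdist x y by rewrite lt0r r0.
have cs : `|v.1 * z1 + v.2 * z2| <= enorm v * Num.sqrt (sqdist x y).
  rewrite -ler_sqr ?nnegrE ?mulr_ge0 ?enorm_ge0 ?sqrtr_ge0// real_normK ?num_real//.
  rewrite exprMn !sqr_sqrtr ?addr_ge0 ?sqr_ge0// /sqdist -/z1 -/z2.
  by have := sqr_ge0 (v.1 * z2 - v.2 * z1); lra.
rewrite (_ : _ + _ = (v.1 * z1 + v.2 * z2) * k); last by ring.
rewrite normrM; apply: le_trans (ler_pM _ _ cs kb) _ => //.
rewrite -{2}(sqr_sqrtr rho0) le_eqVlt; apply/orP; left; apply/eqP.
have := rp; rewrite -sqrtr_gt0; move: (Num.sqrt _) (enorm v) (@pi R) (pi_gt0 R) => s e P P0 s0.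
by field; rewrite !gt_eqF.
Qed.

Lemma field_eq0 a b x y (v : R * R) : 0 < a -> a < b -> 2 * b <= sqdist x y ->
  v.1 * field1 a b x y + v.2 * field2 a b x y = 0.
Proof.
by move=> a0 ab h; rewrite /field1 /field2 profile_eq0 ?mulr0 ?addr0//; right.
Qed.

Lemma kap_ge0 c x y : 0 < c -> 0 <= kap c x y.
Proof. by move=> c0; rewrite divr_ge0 ?dstep_ge0// mulr_ge0 ?pi_ge0// ltW. Qed.

Lemma kap_eq0 c x y : 0 < c -> 2 * c <= sqdist x y -> kap c x y = 0.
Proof. by move=> c0 h; rewrite /kap dstep_eq0 ?mul0r//; right; rewrite ler_pdivlMr. Qed.

Lemma kap_bounded : exists2 K : R, 0 < K & forall c x y, 0 < c -> kap c x y <= K / c.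
Proof.
have [K K0 hK] := @dstep_bounded R.
exists ((K + 1) / pi) => [|c x y c0]; first by rewrite divr_gt0 ?pi_gt0// ltr_wpDl.
rewrite /kap invfM mulrA ler_pM2r ?invr_gt0// ler_pM2r ?invr_gt0 ?pi_gt0//.
by rewrite (le_trans (hK _))// lerDl.
Qed.

Lemma measurable_kap c : measurable_fun [set: plane R * plane R] (fun z => kap c z.1 z.2).
Proof.
apply: measurable_funM => //.
apply: (measurableT_comp measurable_dstep).
by apply: measurable_funM => //; exact: measurable_sqdist.
Qed.

Lemma integral_kap c x : 0 < c -> (\int[leb2]_y (kap c x y)%:E = 1)%E.
Proof.
move=> c0.
have mG : measurable_fun [set: R] (fun t => dstep (t / c) / (pi * c)).
  apply: measurable_funM => //; apply: (measurableT_comp measurable_dstep).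
  exact: measurable_funM.
rewrite (@integral_sqdist _ x (fun t => (dstep (t / c) / (pi * c))%:E)); last 2 first.
- exact/measurable_EFinP.
- by move=> t; rewrite lee_fin divr_ge0 ?dstep_ge0// mulr_ge0 ?pi_ge0// ltW.
rewrite -ge0_integralZl//; last 3 first.
- exact/measurable_EFinP/measurable_funTS.
- by move=> t _; rewrite lee_fin divr_ge0 ?dstep_ge0// mulr_ge0 ?pi_ge0// ltW.
- by rewrite lee_fin pi_ge0.
rewrite -(integral_dstep c0); apply: eq_integral => t _; rewrite -EFinM; congr EFin.
move: (@pi R) (pi_gt0 R) => P P0; field; by rewrite !gt_eqF.
Qed.

End field_estimates.

(** * Representation of averages *)

Section representation.
Context {R : realType}.
Implicit Types (x y : plane R) (a b c t : R) (u : R * R -> R).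

Definition box x (r : R) : set (plane R) :=
  `[(x.1 - r), (x.1 + r)] `*` `[(x.2 - r), (x.2 + r)].

Lemma measurable_box x r : measurable (box x r).
Proof. by apply: measurableX; exact: measurable_itv. Qed.

Lemma integrable_box u x r : locally_integrable2 u ->
  leb2.-integrable (box x r) (EFin \o u : plane R -> \bar R).
Proof.
move=> [mu hu]; apply/integrableP; split.
  by apply/measurable_EFinP; exact: measurable_funTS.
exact: hu (@compact_box R x r).
Qed.

Lemma integrable_mul_bounded u (psi : plane R -> R) x (b K : R) : locally_integrable2 u ->
  measurable_fun [set: plane R] psi -> (forall y, `|psi y| <= K) ->
  (forall y, b <= sqdist x y -> psi y = 0) ->
  leb2.-integrable [set: plane R] (fun y => (u y * psi y)%:E).
Proof.
move=> hu mpsi psiK psi0; pose r := `|b| + 1.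
have K0 : 0 <= K := le_trans (normr_ge0 _) (psiK x).
have mu : measurable_fun [set: plane R] u by case: hu.
have iu := integrable_box x r hu.
have : leb2.-integrable (box x r) (fun y => (u y * psi y)%:E).
  apply: (@le_integrable _ _ _ _ _ _ _ (fun y => (K%:E * (u y)%:E)%E)).
  - exact: measurable_box.
  - by apply/measurable_EFinP/measurable_funTS/measurable_funM.
  - move=> y _; rewrite -EFinM lee_fin !normrM (ger0_norm K0) mulrC.
    by rewrite ler_wpM2r.
  - by apply: integrableZl => //; exact: measurable_box.
move=> /(integrable_mkcond _ (measurable_box x r)).
congr (leb2.-integrable setT _); apply/funext => y.
rewrite patchE; case: ifPn => //; rewrite notin_setE => yb.
rewrite psi0 ?mulr0// leNgt; apply/negP => h; apply: yb.
apply: (@disc_sub_box _ x r); first by rewrite addr_ge0.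
rewrite /disc/= (lt_le_trans h)// /r; have := ler_norm b; have := normr_ge0 b; nra.
Qed.

Lemma measurable_profile a b x :
  measurable_fun [set: plane R] (fun y => kernel_profile a b (sqdist x y)).
Proof.
have ms : measurable_fun [set: R] (@step R).
  apply: continuous_measurable_fun => t.
  apply: differentiable_continuous; apply/derivable1_diffP.
  by apply: (@ex_derive _ _ _ _ _ _ _ (is_derive_step t)).
have mq := measurable_sqdist1 x.
apply: measurable_funM.
  by apply: measurable_funB; apply: (measurableT_comp ms); exact: measurable_funM.
apply: measurable_funV_ge0; first by move=> y; rewrite !mulr_ge0 ?pi_ge0 ?sqdist_ge0.
exact: measurable_funM.
Qed.

Lemma measurable_dprofile a b x :
  measurable_fun [set: plane R] (fun y => dprofile a b (sqdist x y)).
Proof.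
have mq := measurable_sqdist1 x.
apply: measurable_funB; apply: measurable_funM.
- by apply: measurable_funB; apply: measurable_funM => //;
    apply: (measurableT_comp measurable_dstep); exact: measurable_funM.
- apply: measurable_funV_ge0; first by move=> y; rewrite !mulr_ge0 ?pi_ge0 ?sqdist_ge0.
  exact: measurable_funM.
- exact: measurable_profile.
- by apply: measurable_funV_ge0 => // y; exact: sqdist_ge0.
Qed.

Lemma profile_bounded a b t : 0 < a -> a < b -> `|kernel_profile a b t| <= (2 * pi * a)^-1.
Proof.
move=> a0 ab; have [ta|ta] := leP t a.
  by rewrite profile_eq0 ?normr0 ?invr_ge0 ?mulr_ge0 ?pi_ge0 ?(ltW a0)//; left.
apply: le_trans (profile_bound t a0 ab) _.
have tp := lt_trans a0 ta.
by rewrite lef_pV2 ?posrE ?mulr_gt0 ?normr_gt0 ?gt_eqF ?pi_gt0// ler_pM2l ?mulr_gt0 ?pi_gt0// gtr0_norm// ltW.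
Qed.

(** As [w^2 <= |y - x|^2], the derivative term is at most [2 t dprofile] in absolute value, and
    [dprofileE] expresses that through the profile and the two values of [dstep], all bounded. *)
Lemma dfield_bounded a b : 0 < a -> a < b -> exists K, forall x y w,
  w ^+ 2 <= sqdist x y -> `|dfield w a b x y| <= K.
Proof.
move=> a0 ab; have b0 := lt_trans a0 ab; have [K K0 hK] := @dstep_bounded R.
pose C := (2 * pi * a)^-1; exists (3 * C + (K / a + K / b) / pi) => x y w wy.
rewrite /dfield; set t := sqdist x y; set k := kernel_profile a b t.
have kC : `|k| <= C by exact: profile_bounded.
have E := dprofileE t a0 ab; rewrite -/k in E.
set e := (X in _ = X) in E.
have hc c : 0 < c -> `|dstep (t / c) / c| <= K / c.
  move=> c0; rewrite ger0_norm; last by rewrite divr_ge0 ?dstep_ge0// ltW.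
  by rewrite ler_pM2r ?invr_gt0.
have eK : `|e| <= (K / a + K / b) / pi.
  rewrite /e normrM [X in _ * X]ger0_norm ?invr_ge0 ?pi_ge0// ler_wpM2r ?invr_ge0 ?pi_ge0//.
  apply: le_trans (ler_normB _ _) _.
  by apply: lerD; exact: hc.
have t0 : 0 <= t := sqdist_ge0 x y.
have h : `|2 * w ^+ 2 * dprofile a b t| <= `|2 * t * dprofile a b t|.
  rewrite normrM [leRHS]normrM ler_wpM2r//.
  rewrite (ger0_norm (mulr_ge0 _ (sqr_ge0 w)))// (ger0_norm (mulr_ge0 _ t0))//.
  by rewrite ler_wpM2l.
have h2 : 2 * t * dprofile a b t = e - 2 * k by rewrite -E; ring.
rewrite h2 in h; apply: le_trans (ler_normD _ _) _.
have h3 : `|e - 2 * k| <= `|e| + 2 * `|k|.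
  by apply: le_trans (ler_normB _ _) _; rewrite [`|2 * k|]normrM (ger0_norm (ler0n R 2)).
lra.
Qed.

Definition smooth_avg c u x : R := \int[leb2]_y (u y * kap c x y).

Lemma integrable_kap c u x : 0 < c -> locally_integrable2 u ->
  leb2.-integrable [set: plane R] (fun y => (u y * kap c x y)%:E).
Proof.
move=> c0 hu; have [K K0 hK] := @kap_bounded R.
apply: (@integrable_mul_bounded _ _ x (2 * c) (K / c)) => //.
- exact: (measurableT_comp (measurable_kap c) (measurable_pair1 x)).
- by move=> y; rewrite ger0_norm ?kap_ge0// hK.
- by move=> y; exact: kap_eq0.
Qed.

Lemma measurable_field1 a b x : measurable_fun [set: plane R] (field1 a b x).
Proof.
apply: measurable_funM; last exact: measurable_profile.
by apply: measurable_funB.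
Qed.

Lemma measurable_field2 a b x : measurable_fun [set: plane R] (field2 a b x).
Proof.
apply: measurable_funM; last exact: measurable_profile.
by apply: measurable_funB.
Qed.

Lemma integrable_field (G : R * R -> R * R) a b x : 0 < a -> a < b ->
  locally_integrable2 (fun x => (G x).1) -> locally_integrable2 (fun x => (G x).2) ->
  leb2.-integrable [set: plane R] (fun y => ((G y).1 * field1 a b x y)%:E) /\
  leb2.-integrable [set: plane R] (fun y => ((G y).2 * field2 a b x y)%:E).
Proof.
move=> a0 ab hG1 hG2; have b0 := lt_trans a0 ab.
have mfld1 := measurable_field1 a b x.
have mfld2 := measurable_field2 a b x.
have fb (v : R * R) y : `|v.1 * field1 a b x y + v.2 * field2 a b x y| <=
    (2 * pi)^-1 * (enorm v / Num.sqrt a).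
  have C0 : 0 <= (2 * pi)^-1 :> R by rewrite invr_ge0 mulr_ge0 ?pi_ge0.
  have [ra|ra] := leP (sqdist x y) a.
    rewrite /field1 /field2 profile_eq0 ?mulr0 ?addr0 ?normr0//; last by left.
    by rewrite mulr_ge0 ?divr_ge0 ?enorm_ge0 ?sqrtr_ge0.
  apply: le_trans (field_bound x y v a0 ab) _.
  rewrite ler_wpM2l// ler_wpM2l ?enorm_ge0// lef_pV2 ?posrE ?sqrtr_gt0//.
    by rewrite ler_wsqrtr// ltW.
  exact: lt_trans a0 ra.
split.
  apply: (@integrable_mul_bounded _ _ x (2 * b) ((2 * pi)^-1 * (enorm (@e1 R) / Num.sqrt a))) => //.
  - by move=> y; have := fb e1 y; rewrite /= mul1r mul0r addr0.
  - by move=> y h; rewrite /field1 profile_eq0 ?mulr0//; right.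
  apply: (@integrable_mul_bounded _ _ x (2 * b) ((2 * pi)^-1 * (enorm (@e2 R) / Num.sqrt a))) => //.
  - by move=> y; have := fb e2 y; rewrite /= mul1r mul0r add0r.
  - by move=> y h; rewrite /field2 profile_eq0 ?mulr0//; right.
Qed.

(** Each component of the field is tested against its own weak partial derivative, and
    [divergence_field] adds the two identities. All integrands are integrable, so the extended
    integrals may be split as real ones. *)
Lemma representation u (G : R * R -> R * R) a b x : 0 < a -> a < b ->
  locally_integrable2 u -> is_weak_gradient u G ->
  smooth_avg a u x = smooth_avg b u x -
    \int[leb2]_y ((G y).1 * field1 a b x y + (G y).2 * field2 a b x y).
Proof.
move=> a0 ab hu [hG1 hG2 w1 w2]; have b0 := lt_trans a0 ab.
have [K hK] := dfield_bounded a0 ab.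
have mprof := measurable_profile a b x.
have E1 : (\int[leb2]_y (u y * dfield (y.1 - x.1) a b x y)%:E =
    - \int[leb2]_y ((G y).1 * field1 a b x y)%:E)%E.
  rewrite -(w1 _ (test_function_field1 x a0 ab)); apply: eq_integral => y _.
  by congr (_ * _)%:E; exact: (esym (congr1 (fun f => f y) (derive_field1 x a0 ab))).
have E2 : (\int[leb2]_y (u y * dfield (y.2 - x.2) a b x y)%:E =
    - \int[leb2]_y ((G y).2 * field2 a b x y)%:E)%E.
  rewrite -(w2 _ (test_function_field2 x a0 ab)); apply: eq_integral => y _.
  by congr (_ * _)%:E; exact: (esym (congr1 (fun f => f y) (derive_field2 x a0 ab))).
have mdf (w : plane R -> R) : measurable_fun [set: plane R] w ->
    measurable_fun [set: plane R] (fun y => dfield (w y) a b x y).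
  move=> mw; apply: measurable_funD => //; apply: measurable_funM.
    by apply: measurable_funM => //; exact: measurable_funX.
  exact: measurable_dprofile.
have id1 : leb2.-integrable [set: plane R] (fun y => (u y * dfield (y.1 - x.1) a b x y)%:E).
  apply: (@integrable_mul_bounded _ _ x (2 * b) K) => //.
  - by apply: mdf; apply: measurable_funB.
  - by move=> y; apply: hK; rewrite /sqdist lerDl sqr_ge0.
  - by move=> y h; rewrite /dfield profile_eq0 ?dprofile_eq0 ?mulr0 ?addr0//; right.
have id2 : leb2.-integrable [set: plane R] (fun y => (u y * dfield (y.2 - x.2) a b x y)%:E).
  apply: (@integrable_mul_bounded _ _ x (2 * b) K) => //.
  - by apply: mdf; apply: measurable_funB.
  - by move=> y; apply: hK; rewrite /sqdist lerDr sqr_ge0.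
  - by move=> y h; rewrite /dfield profile_eq0 ?dprofile_eq0 ?mulr0 ?addr0//; right.
have [if1 if2] := integrable_field x a0 ab hG1 hG2.
have ika := integrable_kap x a0 hu.
have ikb := integrable_kap x b0 hu.
have F1 : \int[leb2]_y (u y * dfield (y.1 - x.1) a b x y) = - \int[leb2]_y ((G y).1 * field1 a b x y).
  by rewrite /Rintegral E1 fineN.
have F2 : \int[leb2]_y (u y * dfield (y.2 - x.2) a b x y) = - \int[leb2]_y ((G y).2 * field2 a b x y).
  by rewrite /Rintegral E2 fineN.
apply/eqP; rewrite addrC -subr_eq; apply/eqP.
rewrite RintegralD// opprD -F1 -F2 -RintegralD// -RintegralB//.
by apply: eq_Rintegral => y _; rewrite -mulrBr -divergence_field// mulrDr.
Qed.

End representation.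

(** * Almost everywhere convergence of averages *)

Section mollification.
Context {R : realType}.
Implicit Types (x y p q : plane R) (a b c t r : R) (u : R * R -> R).

(** Half-open, like the intervals that generate the Borel sets of the line; integrals over these
    sets will identify the limit of the averages. *)
Definition rect p q : set (plane R) := `]p.1, q.1] `*` `]p.2, q.2].

Lemma measurable_rect p q : measurable (rect p q).
Proof. by apply: measurableX; exact: measurable_itv. Qed.

Definition bigbox r : set (plane R) := box (0, 0) r.

Lemma rect_sub_bigbox p q : exists2 r, 0 <= r & rect p q `<=` bigbox r.
Proof.
exists (`|p.1| + `|p.2| + `|q.1| + `|q.2|); first by rewrite !addr_ge0.
rewrite /bigbox /box => y [/=]; rewrite !in_itv/= !add0r => /andP[h1 h2] /andP[h3 h4].
have := (ler_norm p.1, ler_norm (- p.1), ler_norm q.1, ler_norm p.2, ler_norm (- p.2), ler_norm q.2).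
rewrite !normrN => -[[[[[]]]]] *.
have := (normr_ge0 p.1, normr_ge0 p.2, normr_ge0 q.1, normr_ge0 q.2) => -[[[]]] *.
by split; apply/andP; split; lra.
Qed.

(** The margin 2 exceeds the reach of the kernels in use: [kap c] with [c <= 1] and the potential
    with [t = 2] only see points with [|y - x|^2 <= 2]. *)
Lemma bigbox_far r x y : 0 <= r -> bigbox r x -> ~ bigbox (r + 2) y -> 4 <= sqdist x y.
Proof.
rewrite /bigbox /box /= !in_itv/= !add0r => r0 [/andP[h1 h2] /andP[h3 h4]] h.
rewrite leNgt; apply/negP => h5; apply: h.
have : disc x (2 ^+ 2) y by rewrite /disc/=; lra.
move=> /(disc_sub_box (ler0n _ 2))[/=]; rewrite !in_itv/= => /andP[? ?] /andP[? ?].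
by split; apply/andP; split; lra.
Qed.

Lemma integral_kapC c y : 0 < c -> (\int[leb2]_x (kap c x y)%:E = 1)%E.
Proof.
move=> c0; rewrite -(integral_kap y c0); apply: eq_integral => x _.
by rewrite /kap sqdistC.
Qed.

(** Integrating over the centre [x] instead of [y]: by symmetry the bump also has mass 1 in [x].
    This bound serves both Fubini's theorem and dominated convergence. *)
Lemma integral_rect_kap_le c u p q y : 0 < c ->
  (\int[leb2]_x `|(\1_(rect p q) x * (u y * kap c x y))%:E| <= `|u y|%:E)%E.
Proof.
move=> c0.
apply: (@le_trans _ _ (\int[leb2]_x (`|u y|%:E * (kap c x y)%:E))%E).
  apply: ge0_le_integral => //.
  - apply: measurableT_comp => //; apply/measurable_EFinP.
    apply: measurable_funM; first exact: measurable_indic (measurable_rect p q).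
    apply: measurable_funM => //.
    exact: (measurableT_comp (measurable_kap c) (measurable_pair2 y)).
  - apply: measurable_funeM; apply/measurable_EFinP.
    exact: (measurableT_comp (measurable_kap c) (measurable_pair2 y)).
  move=> x _; rewrite -EFinM lee_fin normrM [X in _ * X]normrM (ger0_norm (kap_ge0 x y c0)).
  apply: ler_piMl; first by rewrite mulr_ge0 ?kap_ge0.
  by rewrite indicE; case: (_ \in _); rewrite ?normr1 ?normr0.
rewrite ge0_integralZl//.
- by rewrite integral_kapC// mule1.
- apply/measurable_EFinP.
  exact: (measurableT_comp (measurable_kap c) (measurable_pair2 y)).
- by move=> x _; rewrite lee_fin kap_ge0.
Qed.

Lemma integrable_kap_prod c u p q : 0 < c -> c <= 1 -> locally_integrable2 u ->
  (leb2 \x leb2)%E.-integrable [set: plane R * plane R]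
    (fun z => (\1_(rect p q) z.1 * (u z.2 * kap c z.1 z.2))%:E).
Proof.
move=> c0 c1 hu; have mu : measurable_fun [set: plane R] u by case: hu.
have mf : measurable_fun [set: plane R * plane R]
    (fun z => \1_(rect p q) z.1 * (u z.2 * kap c z.1 z.2)).
  apply: measurable_funM.
    apply: (measurableT_comp (f := \1_(rect p q) : plane R -> R)) => //.
    exact: measurable_indic (measurable_rect p q).
  apply: measurable_funM; last exact: measurable_kap.
  exact: (measurableT_comp mu).
have mfE : measurable_fun [set: plane R * plane R]
    (fun z => (\1_(rect p q) z.1 * (u z.2 * kap c z.1 z.2))%:E).
  exact/measurable_EFinP.
apply/integrable21ltyP; first exact/measurable_EFinP.
have [r r0 hr] := rect_sub_bigbox p q.
have mB := @measurable_box R (0, 0) (r + 2).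
apply: (@le_lt_trans _ _ (\int[leb2]_(y in bigbox (r + 2)) `|u y|%:E)%E); last first.
  by have [_] := integrableP _ _ _ (integrable_box (0, 0) (r + 2) hu).
rewrite [leRHS]integral_mkcond; apply: ge0_le_integral => //.
- by move=> y _; exact: integral_ge0.
- apply: (measurable_fun_fubini_tonelli_G (m1 := leb2) (abse \o (fun z => (\1_(rect p q) z.1 * (u z.2 * kap c z.1 z.2))%:E))) => //.
    by apply: measurableT_comp => //; exact: mfE.
  by move=> z; exact: abse_ge0.
- apply/(measurable_restrictT (fun y : plane R => `|u y|%:E) mB).
  apply: measurable_funTS; apply: (measurableT_comp (f := EFin)) => //.
  exact: measurableT_comp.
move=> y _; rewrite patchE; case: ifPn => yB; last first.
  rewrite (eq_integral (cst 0%E)) ?integral0// => x _ /=.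
  rewrite indicE; case: (boolP (x \in _)) => [|_]; last by rewrite mul0r normr0.
  rewrite inE => /hr xB; rewrite kap_eq0 ?mulr0 ?normr0//.
  apply: le_trans (bigbox_far r0 xB _); last by rewrite notin_setE in yB.
  by lra.
exact: integral_rect_kap_le.
Qed.

(** The sequence of radii [a]; the shift by 2 keeps every term strictly below 1, the fixed outer
    radius [b] used when passing to the limit. *)
Definition scale n : R := n.+2%:R^-1.

Lemma scale_gt0 n : 0 < scale n. Proof. by rewrite invr_gt0. Qed.

Lemma scale_lt1 n : scale n < 1.
Proof. by rewrite invf_lt1 ?ltr1n. Qed.

Lemma scale_small t : 0 < t -> \forall n \near \oo, 2 * scale n < t.
Proof.
move=> t0; exists (Num.truncn (2 / t)) => // n /= hn.
rewrite /scale ltr_pdivrMr// mulrC -ltr_pdivrMr//.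
by rewrite (lt_le_trans (truncnS_gt _))// ler_nat ltnW.
Qed.

Lemma smooth_avgE c u x : 0 < c -> locally_integrable2 u ->
  (\int[leb2]_y (u y * kap c x y)%:E)%E = (smooth_avg c u x)%:E.
Proof. by move=> c0 hu; rewrite fineK//; apply: integrable_fin_num => //; exact: integrable_kap. Qed.

Lemma rect_avgE c u p q x : 0 < c -> locally_integrable2 u ->
  (\int[leb2]_y (\1_(rect p q) x * (u y * kap c x y))%:E)%E =
  (\1_(rect p q) x * smooth_avg c u x)%:E.
Proof.
move=> c0 hu; under eq_integral do rewrite EFinM.
by rewrite integralZl ?smooth_avgE//; exact: integrable_kap.
Qed.

Lemma integrable_rect_avg c u p q : 0 < c -> c <= 1 -> locally_integrable2 u ->
  leb2.-integrable [set: plane R] (fun x => (\1_(rect p q) x * smooth_avg c u x)%:E).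
Proof.
move=> c0 c1 hu; have := integrable_fubini_F (integrable_kap_prod p q c0 c1 hu).
by apply: eq_integrable => // x _; rewrite /fubini_F rect_avgE.
Qed.

Lemma itv_locally_constant (s t z : R) : z != s -> z != t ->
  exists2 e, 0 < e & forall w, (w - z) ^+ 2 < e -> (s < w <= t) = (s < z <= t).
Proof.
move=> zs zt; pose d := Num.min `|z - s| `|z - t|.
have d0 : 0 < d by rewrite lt_min !normr_gt0 !subr_eq0 zs.
exists (d ^+ 2) => [|w]; first by rewrite exprn_gt0.
rewrite -[X in X < _]real_normK ?num_real// ltr_sqr ?nnegrE ?(ltW d0)// lt_min => /andP[].
rewrite !ltr_norml.
have [h|h|/eqP h] := ltgtP z s; last by rewrite h in zs.
- rewrite (ltr0_norm (x := z - s)) ?subr_lt0// => /andP[_ h1] _.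
  by apply/negbTE; rewrite negb_and -leNgt; apply/orP; left; lra.
- rewrite (gtr0_norm (x := z - s)) ?subr_gt0// => /andP[h1 _].
  have [h2|h2|/eqP h2] := ltgtP z t; last by rewrite h2 in zt.
  + rewrite (ltr0_norm (x := z - t)) ?subr_lt0// => /andP[_ h3].
    by apply/andP; split; lra.
  + rewrite (gtr0_norm (x := z - t)) ?subr_gt0// => /andP[h3 _].
    by apply/negbTE; rewrite negb_and -!ltNge -leNgt; apply/orP; right; lra.
Qed.

(** Off the boundary lines a narrow bump at [y] sees a constant indicator, so the averaged indicator
    is eventually equal to its limit. *)
Lemma rect_locally_constant p q y : y.1 != p.1 -> y.1 != q.1 -> y.2 != p.2 -> y.2 != q.2 ->
  exists2 e, 0 < e & forall x, sqdist x y < e -> \1_(rect p q) x = \1_(rect p q) y :> R.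
Proof.
move=> h1 h2 h3 h4; have [e1 e10 he1] := itv_locally_constant h1 h2.
have [e2 e20 he2] := itv_locally_constant h3 h4.
exists (Num.min e1 e2) => [|x]; first by rewrite lt_min e10.
rewrite lt_min sqdistC => /andP[s1 s2].
have g1 : (x.1 - y.1) ^+ 2 < e1.
  by apply: le_lt_trans s1; rewrite lerDl sqr_ge0.
have g2 : (x.2 - y.2) ^+ 2 < e2.
  by apply: le_lt_trans s2; rewrite lerDr sqr_ge0.
have E : rect p q x = rect p q y by rewrite /rect /= !in_itv/= he1// he2.
rewrite !indicE (_ : (x \in rect p q) = (y \in rect p q))//.
by apply/idP/idP; rewrite !inE E.
Qed.

Lemma ae_off_boundary p q : {ae (leb2 : set (plane R) -> \bar R), forall y,
  [/\ y.1 != p.1, y.1 != q.1, y.2 != p.2 & y.2 != q.2]}.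
Proof.
have n1 (s : R) : leb2.-negligible ([set s] `*` [set: measurableTypeR R] : set (plane R)).
  exists ([set s] `*` setT); split => //; first exact: measurableX.
  rewrite [LHS]product_measure1E//.
  rewrite [X in (X * _)%E](_ : _ = 0%E) ?mul0e//.
  exact: countable_lebesgue_measure0 (countable1 s).
have n2 (s : R) : leb2.-negligible ([set: measurableTypeR R] `*` [set s] : set (plane R)).
  exists (setT `*` [set s]); split => //; first exact: measurableX.
  rewrite [LHS]product_measure1E//.
  rewrite [X in (_ * X)%E](_ : _ = 0%E) ?mule0//.
  exact: countable_lebesgue_measure0 (countable1 s).
have := negligibleU (negligibleU (n1 p.1) (n1 q.1)) (negligibleU (n2 p.2) (n2 q.2)).
apply: negligibleS => y /= h.
have [->|h1] := eqVneq y.1 p.1; first by left; left.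
have [->|h2] := eqVneq y.1 q.1; first by left; right.
have [->|h3] := eqVneq y.2 p.2; first by right; left.
have [->|h4] := eqVneq y.2 q.2; first by right; right.
by exfalso; apply: h; split.
Qed.

End mollification.

Section rect_limit.
Context {R : realType}.
Implicit Types (x y p q : plane R) (a b c t r : R) (u : R * R -> R).

(** Fubini's theorem moves the average from [u] to the indicator. The averaged indicator is
    eventually stationary off the null boundary, and [|u|] on an enlarged box dominates. *)
Lemma cvg_integral_rect_avg u p q : locally_integrable2 u ->
  (\int[leb2]_x (\1_(rect p q) x * smooth_avg (scale n) u x)%:E)%E @[n --> \oo] -->
  (\int[leb2]_y (\1_(rect p q) y * u y)%:E)%E.
Proof.
move=> hu; have mu : measurable_fun [set: plane R] u by case: hu.
pose Phi n (z : plane R * plane R) := (\1_(rect p q) z.1 * (u z.2 * kap (scale n) z.1 z.2))%:E.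
have iPhi n : (leb2 \x leb2)%E.-integrable [set: plane R * plane R] (Phi n).
  by apply: integrable_kap_prod => //; [exact: scale_gt0|exact/ltW/scale_lt1].
pose f n (y : plane R) := (\int[leb2]_x Phi n (x, y))%E.
have -> : (fun n => (\int[leb2]_x (\1_(rect p q) x * smooth_avg (scale n) u x)%:E)%E) =
    (fun n => (\int[leb2]_y f n y)%E).
  apply/funext => n; rewrite /f -(Fubini (iPhi n)).
  by apply: eq_integral => x _; rewrite -rect_avgE//; exact: scale_gt0.
have [r r0 hr] := rect_sub_bigbox p q.
have mB := @measurable_box R (0, 0) (r + 2).
pose g (y : plane R) := ((fun y : plane R => `|u y|%:E) \_ (bigbox (r + 2))) y.
have f_le n y : (`|f n y| <= g y)%E.
  apply: le_trans (le_abse_integral _ _ _) _ => //.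
    exact: (measurableT_comp (measurable_int _ (iPhi n)) (measurable_pair2 y)).
  rewrite /g patchE; case: ifPn => yB; first exact: integral_rect_kap_le (scale_gt0 n).
  rewrite (eq_integral (cst 0%E)) ?integral0// => x _ /=.
  rewrite indicE; case: (boolP (x \in _)) => [|_]; last by rewrite mul0r normr0.
  rewrite inE => /hr xB; rewrite kap_eq0 ?scale_gt0 ?mulr0 ?normr0//.
  apply: le_trans (bigbox_far r0 xB _); last by rewrite notin_setE in yB.
  by have := @scale_lt1 R n; lra.
have ig : leb2.-integrable [set: plane R] g.
  apply: (integrable_mkcond (fun y : plane R => `|u y|%:E) mB).1.
  exact: (integrable_abse (integrable_box (0, 0) (r + 2) hu)).
have mfn n : measurable_fun [set: plane R] (f n).
  exact: measurable_fubini_G (iPhi n).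
have fcvg : {ae leb2, forall y : plane R, [set: plane R] y ->
    f n y @[n --> \oo] --> (\1_(rect p q) y * u y)%:E}.
  apply: filterS (ae_off_boundary p q) => y [h1 h2 h3 h4] _.
  have [e e0 he] := rect_locally_constant h1 h2 h3 h4.
  apply: cvg_near_cst.
  have := scale_small e0; apply: filterS => n ne.
  transitivity (\int[leb2]_x ((\1_(rect p q) y * u y)%:E * (kap (scale n) x y)%:E))%E.
    apply: eq_integral => x _; rewrite /Phi/= -EFinM.
    have [xe|xe] := ltP (sqdist x y) e; first by rewrite (he _ xe) mulrA.
    by rewrite kap_eq0 ?scale_gt0 ?mulr0 ?mulr0// (le_trans (ltW ne)).
  rewrite integralZl//; first by rewrite integral_kapC ?scale_gt0 ?mule1.
  apply/integrableP; split.
    apply/measurable_EFinP.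
    exact: (measurableT_comp (measurable_kap (scale n)) (measurable_pair2 y)).
  rewrite (eq_integral (fun x => (kap (scale n) x y)%:E)).
    by rewrite integral_kapC ?scale_gt0 ?ltry.
  by move=> x _ /=; rewrite ger0_norm ?kap_ge0 ?scale_gt0.
have mF : measurable_fun [set: plane R] (fun y => (\1_(rect p q) y * u y)%:E).
  apply/measurable_EFinP; apply: measurable_funM => //.
  exact: measurable_indic (measurable_rect p q).
have [] := dominated_convergence measurableT mfn mF fcvg ig.
  by apply: aeW => y n _.
by [].
Qed.

End rect_limit.

(** * Local integrability of the potential of the gradient *)

Section potential.
Context {R : realType}.
Implicit Types (x y p q : plane R) (a b c t r : R) (u : R * R -> R) (G : R * R -> R * R).

Lemma measurable_smooth_avg c u : measurable_fun [set: plane R] u ->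
  measurable_fun [set: plane R] (smooth_avg c u).
Proof.
move=> mu; pose f (z : plane R * plane R) := (u z.2 * kap c z.1 z.2)%:E.
have mf : measurable_fun [set: plane R * plane R] f.
  apply/measurable_EFinP; apply: measurable_funM; last exact: measurable_kap.
  exact: (measurableT_comp mu).
rewrite (_ : smooth_avg c u = fine \o ((fun x => \int[leb2]_y f^\+ (x, y)) \-
    (fun x => \int[leb2]_y f^\- (x, y))))%E; last first.
  apply/funext => x; rewrite /smooth_avg /Rintegral /=; congr fine.
  rewrite integralE; congr (_ - _)%E; apply: eq_integral => y _.
  - by rewrite !funeposE.
  - by rewrite !funenegE.
apply: (measurableT_comp (@fine_measurable R _ measurableT)) => //.
apply: emeasurable_funB.
- by apply: measurable_fun_fubini_tonelli_F => //; exact: measurable_funepos.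
- by apply: measurable_fun_fubini_tonelli_F => //; exact: measurable_funeneg.
Qed.

Lemma measurable_enorm G : measurable_fun [set: plane R] (fun x => (G x).1) ->
  measurable_fun [set: plane R] (fun x => (G x).2) ->
  measurable_fun [set: plane R] (fun x => enorm (G x)).
Proof.
move=> m1 m2; apply: (measurableT_comp (f := @Num.sqrt R)).
  by apply: continuous_measurable_fun; exact: sqrt_continuous.
by apply: measurable_funD; exact: measurable_funX.
Qed.

Lemma enorm_le (v : R * R) : enorm v <= `|v.1| + `|v.2|.
Proof.
rewrite -ler_sqr ?nnegrE ?addr_ge0 ?enorm_ge0// sqr_sqrtr ?addr_ge0 ?sqr_ge0//.
rewrite -(real_normK (num_real v.1)) -(real_normK (num_real v.2)).
by have := normr_ge0 v.1; have := normr_ge0 v.2; nra.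
Qed.

(** A truncated Riesz potential of order 1: the [I(x)] of the overview for [t = 2c]. It is
    extended-valued, since it may be infinite at some points. *)
Definition potential t (f : plane R -> R) x : \bar R :=
  (\int[leb2]_(y in disc x t) (f y / Num.sqrt (sqdist x y))%:E)%E.

Lemma sqrtV_powR (s : R) : 0 <= s -> (Num.sqrt s)^-1 = s `^ (- 2^-1).
Proof. by move=> s0; rewrite powRN powR12_sqrt. Qed.

Lemma measurable_sqrt_sqdistV : measurable_fun [set: plane R * plane R]
  (fun z => (Num.sqrt (sqdist z.1 z.2))^-1).
Proof.
apply: measurable_funV_ge0 => [z|]; first exact: sqrtr_ge0.
apply: (measurableT_comp (f := @Num.sqrt R)); last exact: measurable_sqdist.
by apply: continuous_measurable_fun; exact: sqrt_continuous.
Qed.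

(** Tonelli's theorem: for fixed [y] the kernel [1 / |y - x|] has integral at most [C] in [x], by
    [integral_disc_powR] with exponent [1/2]; only [y] in an enlarged box contribute. *)
Lemma integrable_potential (f : plane R -> R) p q :
  (forall y, 0 <= f y) -> measurable_fun [set: plane R] f ->
  (forall r, (\int[leb2]_(y in bigbox r) (f y)%:E < +oo)%E) ->
  (\int[leb2]_(x in rect p q) potential 2 f x < +oo)%E.
Proof.
move=> f0 mf intf; have [r r0 hr] := rect_sub_bigbox p q.
have mB := @measurable_box R (0, 0) (r + 2).
pose h (z : plane R * plane R) : \bar R :=
  (\1_(rect p q) z.1 * (\1_`]-oo, 2%R[ (sqdist z.1 z.2) * (f z.2 / Num.sqrt (sqdist z.1 z.2))))%:E.
have h0 z : (0 <= h z)%E.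
  by rewrite lee_fin !mulr_ge0 ?invr_ge0 ?sqrtr_ge0.
have mh : measurable_fun [set: plane R * plane R] h.
  apply/measurable_EFinP; apply: measurable_funM.
    apply: (measurableT_comp (f := \1_(rect p q) : plane R -> R)) => //.
    exact: measurable_indic (measurable_rect p q).
  apply: measurable_funM; last first.
    by apply: measurable_funM; [exact: (measurableT_comp mf)|exact: measurable_sqrt_sqdistV].
  apply: (measurableT_comp (f := \1_`]-oo, 2%R[ : R -> R)); last exact: measurable_sqdist.
  exact: measurable_indic (measurable_itv _).
have -> : (\int[leb2]_(x in rect p q) potential 2 f x = \int[leb2]_x \int[leb2]_y h (x, y))%E.
  rewrite integral_mkcond; apply: eq_integral => x _; rewrite patchE /h/=.
  rewrite [in RHS]indicE; case: (x \in _); last first.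
    by rewrite -[LHS](integral0 leb2 setT); apply: eq_integral => y _; rewrite mul0r.
  rewrite /potential integral_mkcond; apply: eq_integral => y _.
  rewrite patchE mul1r indicE; case: ifPn; rewrite ?notin_setE ?inE /disc/= => hy.
    by rewrite mem_set ?mul1r//= in_itv.
  by rewrite memNset ?mul0r//= in_itv.
rewrite (fubini_tonelli (m1 := leb2) (m2 := leb2))//.
pose C : R := pi * (2 `^ (1 - 2^-1) / (1 - 2^-1)).
have C0 : 0 <= C by rewrite mulr_ge0 ?pi_ge0// divr_ge0 ?powR_ge0//; lra.
apply: (@le_lt_trans _ _ (\int[leb2]_(y in bigbox (r + 2)) (C * f y)%:E)%E); last first.
  under eq_integral do rewrite EFinM.
  rewrite ge0_integralZl//; last 2 first.
    exact/measurable_EFinP/measurable_funTS.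
    by move=> y _; rewrite lee_fin.
  by rewrite lte_mul_pinfty// ?lee_fin.
rewrite [leRHS]integral_mkcond; apply: ge0_le_integral => //.
- by move=> y _; exact: integral_ge0.
- exact: measurable_fun_fubini_tonelli_G.
- apply/(measurable_restrictT (fun y : plane R => (C * f y)%:E) mB).
  by apply/measurable_EFinP/measurable_funTS/measurable_funM.
move=> y _; rewrite patchE; case: ifPn => yB; last first.
  rewrite (eq_integral (cst 0%E)) ?integral0// => x _ /=.
  rewrite /h/= !indicE; case: (boolP (x \in _)) => [|_]; last by rewrite mul0r.
  rewrite inE => /hr xB.
  have h4 : 4 <= sqdist x y by apply: (bigbox_far r0 xB); move: yB; rewrite notin_setE.
  rewrite (_ : (sqdist x y \in _) = false) ?mul0r ?mulr0//.
  by apply/negbTE; rewrite notin_setE/= in_itv/= => h5; lra.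
apply: (@le_trans _ _ (\int[leb2]_(x in disc y 2) ((f y)%:E * (sqdist y x `^ (- 2^-1))%:E))%E).
  rewrite [leRHS]integral_mkcond; apply: ge0_le_integral => //.
  - exact: (measurableT_comp mh (measurable_pair2 y)).
  - apply/(measurable_restrictT (fun x : plane R => ((f y)%:E * (sqdist y x `^ (- 2^-1))%:E)%E) (measurable_disc y 2)).
    apply: measurable_funTS; apply: measurable_funeM; apply/measurable_EFinP.
    exact: (measurableT_comp (measurable_powR _) (measurable_sqdist1 y)).
  - move=> x _; rewrite patchE /h/= sqrtV_powR ?sqdist_ge0// (sqdistC x y).
    have fp : 0 <= f y * sqdist y x `^ (- 2^-1) by rewrite mulr_ge0 ?powR_ge0.
    case: ifPn; rewrite ?notin_setE ?inE /disc/= => hy.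
      rewrite -EFinM lee_fin !indicE mulrA ler_piMl//.
      by case: (_ \in _); case: (_ \in _); rewrite ?mul0r ?mulr0 ?mul1r.
    by rewrite [X in _ * (X * _)]indicE memNset ?mul0r ?mulr0//= in_itv.
rewrite ge0_integralZl//.
- by rewrite mulrC EFinM lee_wpmul2l ?lee_fin// integral_disc_powR//; lra.
- exact: measurable_disc.
- apply: measurable_funTS; apply/measurable_EFinP.
  exact: (measurableT_comp (measurable_powR _) (measurable_sqdist1 y)).
- by move=> x _; rewrite lee_fin powR_ge0.
by rewrite lee_fin.
Qed.

End potential.

Section pointwise.
Context {R : realType}.
Implicit Types (x y p q : plane R) (a b c t r : R) (u : R * R -> R) (G : R * R -> R * R).

Let fieldG G a b x y := (G y).1 * field1 a b x y + (G y).2 * field2 a b x y.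

Lemma field_le_potential G a b x y : 0 < a -> a < b ->
  (`|(fieldG G a b x y)%:E| <= (2 * pi)^-1%:E *
     (((fun y => (enorm (G y) / Num.sqrt (sqdist x y))%:E) \_ (disc x (2 * b))) y))%E.
Proof.
move=> a0 ab; rewrite patchE; case: ifPn; rewrite ?notin_setE ?inE => yD.
  by rewrite -EFinM lee_fin; exact: field_bound.
rewrite mule0 /fieldG field_eq0//=; first by rewrite normr0.
by rewrite leNgt; apply/negP.
Qed.

Lemma measurable_potential_integrand G x :
  measurable_fun [set: plane R] (fun y => enorm (G y)) ->
  measurable_fun [set: plane R] (fun y => (enorm (G y) / Num.sqrt (sqdist x y))%:E).
Proof.
move=> mG; apply/measurable_EFinP; apply: measurable_funM => //.
exact: (measurableT_comp measurable_sqrt_sqdistV (measurable_pair1 x)).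
Qed.

(** The right side does not depend on [a]: it is both a dominating function for the averages and the
    estimate that survives in the limit. *)
Lemma smooth_avg_le u G a b x : 0 < a -> a < b ->
  locally_integrable2 u -> is_weak_gradient u G ->
  (`|smooth_avg a u x|%:E <= `|smooth_avg b u x|%:E +
     (2 * pi)^-1%:E * potential (2 * b) (fun y => enorm (G y)) x)%E.
Proof.
move=> a0 ab hu hG; rewrite (representation x a0 ab hu hG).
have [hG1 hG2 _ _] := hG.
have [if1 if2] := integrable_field x a0 ab hG1 hG2.
have mG : measurable_fun [set: plane R] (fun y => enorm (G y)).
  by apply: measurable_enorm; [case: hG1|case: hG2].
have mP := measurable_potential_integrand x mG.
have iF : leb2.-integrable [set: plane R] (fun y => (fieldG G a b x y)%:E).
  have := integrableD measurableT if1 if2.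
  by apply: eq_integrable => // y _; rewrite /= -EFinD.
apply: (@le_trans _ _ (`|smooth_avg b u x|%:E + `|\int[leb2]_y fieldG G a b x y|%:E)%E).
  by rewrite -EFinD lee_fin ler_normB.
rewrite leeD2l//.
apply: (@le_trans _ _ (\int[leb2]_y `|(fieldG G a b x y)%:E|)%E).
  rewrite EFin_normr_Rintegral//.
  by apply: le_abse_integral => //; case/integrableP: iF.
rewrite /potential [in leRHS]integral_mkcond -ge0_integralZl//; last 3 first.
- exact/(measurable_restrictT _ (measurable_disc x _))/measurable_funTS.
- move=> y _; rewrite patchE; case: ifP => // _.
  by rewrite lee_fin divr_ge0 ?enorm_ge0 ?sqrtr_ge0.
- by rewrite lee_fin invr_ge0 mulr_ge0 ?pi_ge0.
apply: ge0_le_integral => //.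
- by apply: measurableT_comp => //; case/integrableP: iF.
- apply: measurable_funeM.
  exact/(measurable_restrictT _ (measurable_disc x _))/measurable_funTS.
- by move=> y _; exact: field_le_potential.
Qed.

(** Only the existence of the limit, by [representation] with outer radius 1 and dominated
    convergence under the finite potential. Its value is identified later. *)
Lemma cvg_smooth_avg u G x : locally_integrable2 u -> is_weak_gradient u G ->
  (potential 2 (fun y => enorm (G y)) x < +oo)%E ->
  cvgn (fun n => smooth_avg (scale n) u x).
Proof.
move=> hu hG Pfin.
have [hG1 hG2 _ _] := hG.
have mG : measurable_fun [set: plane R] (fun y => enorm (G y)).
  by apply: measurable_enorm; [case: hG1|case: hG2].
have mP := measurable_potential_integrand x mG.
have s1 n := @scale_lt1 R n; have s0 n := @scale_gt0 R n.
(* The field with its inner truncation removed, paired with [G]. At each [y] the truncated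
   integrands are eventually equal to it, and at [y = x] all of them vanish. *)
pose F y := (1 - step (sqdist x y)) / (2 * pi * sqdist x y) * ((G y).1 * (y.1 - x.1) + (G y).2 * (y.2 - x.2)).
have ifn n : leb2.-integrable [set: plane R] (fun y => (fieldG G (scale n) 1 x y)%:E).
  have [if1 if2] := integrable_field x (s0 n) (s1 n) hG1 hG2.
  have := integrableD measurableT if1 if2.
  by apply: eq_integrable => // y _; rewrite /= -EFinD.
have mfn n := measurable_int _ (ifn n).
have cF y : (fieldG G (scale n) 1 x y)%:E @[n --> \oo] --> (F y)%:E.
  apply: cvg_near_cst.
  have := sqdist_ge0 x y; rewrite le_eqVlt => /predU1P[r0|r0].
    apply: nearW => n; congr EFin; rewrite /fieldG /F /field1 /field2.
    have : y.1 - x.1 = 0 /\ y.2 - x.2 = 0.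
      have := sqr_ge0 (y.1 - x.1); have := sqr_ge0 (y.2 - x.2).
      move: r0; rewrite /sqdist => r0 h1 h2.
      by split; apply/eqP; rewrite -sqrf_eq0; apply/eqP; lra.
    by move=> [-> ->]; rewrite !mul0r !mulr0 addr0 mulr0.
  have := scale_small r0; apply: filterS => n hn.
  rewrite /fieldG /F /field1 /field2 /kernel_profile divr1 (@step_eq1 _ (_ / scale n)); last first.
    by rewrite ler_pdivlMr// ltW.
  by congr EFin; ring.
have mF : measurable_fun [set: plane R] (fun y => (F y)%:E).
  exact: (emeasurable_fun_cvg _ _ mfn).
pose g y := ((2 * pi)^-1%:E * (((fun y => (enorm (G y) / Num.sqrt (sqdist x y))%:E) \_ (disc x 2)) y))%E.
have mg : measurable_fun [set: plane R] g.
  apply: measurable_funeM.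
  exact/(measurable_restrictT _ (measurable_disc x _))/measurable_funTS.
have g0 y : (0 <= ((fun y => (enorm (G y) / Num.sqrt (sqdist x y))%:E) \_ (disc x 2)) y)%E.
  rewrite patchE; case: ifP => // _.
  by rewrite lee_fin divr_ge0 ?enorm_ge0 ?sqrtr_ge0.
have C0 : (0 <= (2 * pi : R)^-1%:E)%E by rewrite lee_fin invr_ge0 mulr_ge0 ?pi_ge0.
have ig : leb2.-integrable [set: plane R] g.
  apply/integrableP; split => //.
  under eq_integral do rewrite gee0_abs ?mule_ge0//.
  rewrite ge0_integralZl//; last first.
    exact/(measurable_restrictT _ (measurable_disc x _))/measurable_funTS.
  by rewrite -integral_mkcond lte_mul_pinfty.
have fg n y : (`|(fieldG G (scale n) 1 x y)%:E| <= g y)%E.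
  by have := field_le_potential G x y (s0 n) (s1 n); rewrite mulr1.
have [iF _ cI] := dominated_convergence measurableT mfn mF (aeW _ (fun y _ => cF y)) ig (aeW _ (fun y n _ => fg n y)).
have -> : (fun n => smooth_avg (scale n) u x) =
   (fun n => smooth_avg 1 u x - fine (\int[leb2]_y (fieldG G (scale n) 1 x y)%:E)%E).
  by apply/funext => n; rewrite (representation x (s0 n) (s1 n) hu hG).
apply/cvg_ex; eexists; apply: cvgB; first exact: cvg_cst.
apply: (@fine_cvg _ _ _ _ _ (fine (\int[leb2]_y (F y)%:E)%E)).
by rewrite fineK; [exact: cI|exact: integrable_fin_num].
Qed.

End pointwise.

(** * Rectangles determine integrable functions *)

Section rectangles.
Context {R : realType}.
Implicit Types (x y p q : plane R).

Definition rects : set (set (plane R)) := [set A | exists p q, A = rect p q].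

Lemma rectI p q p' q' : rect p q `&` rect p' q' =
  rect (Num.max p.1 p'.1, Num.max p.2 p'.2) (Num.min q.1 q'.1, Num.min q.2 q'.2).
Proof.
apply/seteqP; split => y; rewrite /rect /= !in_itv/= !gt_max !le_min.
  by move=> [[/andP[-> ->] /andP[-> ->]] [/andP[-> ->] /andP[-> ->]]].
by move=> [/andP[/andP[-> ->] /andP[-> ->]] /andP[/andP[-> ->] /andP[-> ->]]].
Qed.

Lemma setI_closed_rects : setI_closed rects.
Proof. by move=> _ _ [p [q ->]] [p' [q' ->]]; rewrite rectI; do 2 eexists. Qed.

(** Vertical and horizontal strips over half-open intervals are countable unions of rectangles, so
    both projections are measurable for the generated sigma-algebra. *)
Lemma measurable_rects : @measurable _ (plane R) = <<s rects >>.
Proof.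
rewrite eqEsubset; split; last first.
  apply: smallest_sub; first exact: sigma_algebra_measurable.
  by move=> _ [p [q ->]]; exact: measurable_rect.
pose T := g_sigma_algebraType rects.
have cover : [set: R] = \bigcup_n `](- n%:R), n%:R]%classic.
  apply/seteqP; split => // t _; exists (Num.truncn `|t|).+1 => //=.
  have := truncnS_gt `|t|; rewrite in_itv/= ltr_norml => /andP[-> h].
  exact: ltW.
have mfst : measurable_fun [set: T] (fst : T -> measurableTypeR R).
  apply: (measurability _ (erefl (@measurable _ (measurableTypeR R)))).
  move=> _ [_ [[a b] _ <-] <-]; rewrite setTI.
  have -> : fst @^-1` `]a, b]%classic = \bigcup_n (rect (a, - n%:R) (b, n%:R)).
    apply/seteqP; split => [z za|z [n _ []]//].
    have [n _ zn] : (\bigcup_n `](- n%:R), n%:R]%classic) z.2 by rewrite -cover.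
    by exists n.
  by apply: bigcupT_measurable => n; apply: sub_sigma_algebra; do 2 eexists.
have msnd : measurable_fun [set: T] (snd : T -> measurableTypeR R).
  apply: (measurability _ (erefl (@measurable _ (measurableTypeR R)))).
  move=> _ [_ [[a b] _ <-] <-]; rewrite setTI.
  have -> : snd @^-1` `]a, b]%classic = \bigcup_n (rect (- n%:R, a) (n%:R, b)).
    apply/seteqP; split => [z za|z [n _ []]//].
    have [n _ zn] : (\bigcup_n `](- n%:R), n%:R]%classic) z.1 by rewrite -cover.
    by exists n.
  by apply: bigcupT_measurable => n; apply: sub_sigma_algebra; do 2 eexists.
rewrite measurable_prod_measurableType; apply: smallest_sub.
  exact: (@sigma_algebra_measurable _ T).
move=> _ [A mA [B mB <-]].
have := @measurableI _ T _ _ (mfst measurableT _ mA) (msnd measurableT _ mB).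
by rewrite !setTI.
Qed.

(** Dynkin's argument inside a fixed rectangle. Equality on the whole rectangle, itself an
    admissible one, gives stability under complements, and finiteness of the integrals permits the
    subtraction. *)
Lemma eq_integral_rects p q (f g : plane R -> \bar R) :
  leb2.-integrable (rect p q) f -> leb2.-integrable (rect p q) g ->
  (forall p' q', rect p' q' `<=` rect p q ->
    \int[leb2]_(x in rect p' q') f x = \int[leb2]_(x in rect p' q') g x)%E ->
  forall S, measurable S ->
    (\int[leb2]_(x in S `&` rect p q) f x = \int[leb2]_(x in S `&` rect p q) g x)%E.
Proof.
move=> intf intg fg.
have mD := measurable_rect p q; set D := rect p q in intf intg fg mD *.
have fgD : (\int[leb2]_(x in D) f x = \int[leb2]_(x in D) g x)%E by exact: fg.
have sub (h : plane R -> \bar R) S : leb2.-integrable D h -> measurable S ->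
    leb2.-integrable (S `&` D) h.
  move=> ih mS; apply: integrableS ih => //; first exact: measurableI.
have compl (h : plane R -> \bar R) S : leb2.-integrable D h -> measurable S ->
    (\int[leb2]_(x in ~` S `&` D) h x = \int[leb2]_(x in D) h x - \int[leb2]_(x in S `&` D) h x)%E.
  move=> ih mS.
  have DE : D = (S `&` D) `|` (~` S `&` D) by rewrite -setIUl setUv setTI.
  rewrite [in RHS]DE integral_setU -?DE.
  - rewrite addeAC subee ?add0e//; apply: integrable_fin_num; last exact: sub.
    exact: measurableI.
  - exact: measurableI.
  - by apply: measurableI => //; exact: measurableC.
  - by case/integrableP: ih.
  - by apply/disj_setPS => y [[Sy _] [nSy _]].
move=> S mS; move: mS; rewrite measurable_rects.
apply: (@dynkin_induction _ _ rects (fun S =>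
  \int[leb2]_(x in S `&` D) f x = \int[leb2]_(x in S `&` D) g x)%E).
- exact: measurable_rects.
- exact: setI_closed_rects.
- by rewrite setTI.
- by move=> _ [p' [q' ->]]; rewrite /D rectI; apply: fg; rewrite -rectI.
- by move=> S' mS' h; rewrite !compl// h fgD.
- move=> F mF tF h; rewrite setI_bigcupl.
  have tF' : trivIset setT (fun k => F k `&` D) by exact: trivIset_setIr.
  have mF' k : measurable (F k `&` D) by exact: measurableI.
  have iF (h' : plane R -> \bar R) : leb2.-integrable D h' -> leb2.-integrable (\bigcup_k (F k `&` D)) h'.
    move=> ih; rewrite -setI_bigcupl; apply: sub => //; exact: bigcupT_measurable.
  rewrite !integral_bigcup//; try exact: iF.
  by apply: eq_eseriesr => k _.
Qed.

End rectangles.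

(** * The limit of the averages is [u] *)

Section identification.
Context {R : realType}.
Implicit Types (x y p q : plane R) (a b c t r : R) (u : R * R -> R) (G : R * R -> R * R).

Lemma measurable_potential (f : plane R -> R) t : (forall y, 0 <= f y) ->
  measurable_fun [set: plane R] f -> measurable_fun [set: plane R] (potential t f).
Proof.
move=> f0 mf.
pose h (z : plane R * plane R) : \bar R :=
  (\1_`]-oo, t[ (sqdist z.1 z.2) * (f z.2 / Num.sqrt (sqdist z.1 z.2)))%:E.
have h0 z : (0 <= h z)%E.
  by rewrite lee_fin !mulr_ge0 ?invr_ge0 ?sqrtr_ge0.
have mh : measurable_fun [set: plane R * plane R] h.
  apply/measurable_EFinP; apply: measurable_funM; last first.
    by apply: measurable_funM; [exact: (measurableT_comp mf)|exact: measurable_sqrt_sqdistV].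
  apply: (measurableT_comp (f := \1_`]-oo, t[ : R -> R)); last exact: measurable_sqdist.
  exact: measurable_indic (measurable_itv _).
rewrite (_ : potential t f = fun x => \int[leb2]_y h (x, y))%E.
  exact: measurable_fun_fubini_tonelli_F.
apply/funext => x; rewrite /potential integral_mkcond; apply: eq_integral => y _.
rewrite patchE /h/= indicE; case: ifPn; rewrite ?notin_setE ?inE /disc/= => hy.
  by rewrite mem_set ?mul1r//= in_itv.
by rewrite memNset ?mul0r//= in_itv.
Qed.

Lemma integral_indic_rect p q (f : plane R -> R) :
  (\int[leb2]_x (\1_(rect p q) x * f x)%:E = \int[leb2]_(x in rect p q) (f x)%:E)%E.
Proof.
rewrite [RHS]integral_mkcond; apply: eq_integral => x _.
by rewrite patchE indicE; case: (_ \in _); rewrite ?mul1r ?mul0r.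
Qed.

Lemma integrable_indic_rect p q (f : plane R -> R) :
  leb2.-integrable [set: plane R] (fun x => (\1_(rect p q) x * f x)%:E) ->
  leb2.-integrable (rect p q) (fun x => (f x)%:E).
Proof.
move=> ih; apply/(integrable_mkcond _ (measurable_rect p q)).
apply: eq_integrable ih => // x _.
by rewrite patchE indicE; case: (_ \in _); rewrite ?mul1r ?mul0r.
Qed.

Lemma potential_ge0 (f : plane R -> R) t x : (forall y, 0 <= f y) -> (0 <= potential t f x)%E.
Proof.
by move=> f0; apply: integral_ge0 => y _; rewrite lee_fin divr_ge0 ?sqrtr_ge0.
Qed.

Lemma integrable_rect p q u : locally_integrable2 u -> leb2.-integrable (rect p q) (fun x => (u x)%:E).
Proof.
move=> hu; have [r r0 hr] := rect_sub_bigbox p q.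
by apply: integrableS (integrable_box (0, 0) r hu) => //;
  [exact: measurable_box|exact: measurable_rect].
Qed.

Lemma potential_fin_rect G p q :
  locally_integrable2 (fun x => (G x).1) -> locally_integrable2 (fun x => (G x).2) ->
  (\int[leb2]_(x in rect p q) potential 2 (fun y => enorm (G y)) x < +oo)%E.
Proof.
move=> h1 h2.
have mG : measurable_fun [set: plane R] (fun y => enorm (G y)).
  by apply: measurable_enorm; [case: h1|case: h2].
apply: integrable_potential => //; first by move=> y; exact: enorm_ge0.
move=> r; have mB := @measurable_box R (0, 0) r.
apply: (@le_lt_trans _ _ (\int[leb2]_(y in bigbox r) (`|(G y).1%:E| + `|(G y).2%:E|))%E).
  apply: ge0_le_integral => //.
  - by move=> y _; rewrite lee_fin enorm_ge0.
  - exact/measurable_funTS/measurable_EFinP.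
  - by apply: measurable_funTS; apply: emeasurable_funD;
      apply: measurableT_comp => //; apply/measurable_EFinP; [case: h1|case: h2].
  - by move=> y _; rewrite -EFinD lee_fin enorm_le.
have i1 := integrable_abse (integrable_box (0, 0) r h1).
have i2 := integrable_abse (integrable_box (0, 0) r h2).
have /integrableP[_] := integrableD mB i1 i2; apply: le_lt_trans.
rewrite le_eqVlt; apply/orP; left; apply/eqP; apply: eq_integral => y _.
by rewrite [RHS]gee0_abs//; apply: adde_ge0; exact: abse_ge0.
Qed.

(** The averages converge wherever the potential is finite. Over small rectangles their integrals
    tend to those of the limit by domination, and to those of [u] by [cvg_integral_rect_avg]; hence
    limit and [u] agree almost everywhere. *)
Lemma ae_cvg_smooth_avg_rect u G p q : locally_integrable2 u -> is_weak_gradient u G ->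
  {ae leb2, forall x : plane R, rect p q x ->
     smooth_avg (scale n) u x @[n --> \oo] --> u x}.
Proof.
move=> hu hG; have [hG1 hG2 _ _] := hG.
have mu : measurable_fun [set: plane R] u by case: hu.
have mG : measurable_fun [set: plane R] (fun y => enorm (G y)).
  by apply: measurable_enorm; [case: hG1|case: hG2].
have s1 n := @scale_lt1 R n; have s0 n := @scale_gt0 R n.
set D := rect p q; have mD : measurable D := measurable_rect p q.
pose P := potential 2 (fun y => enorm (G y)).
have P0 x : (0 <= P x)%E by apply: potential_ge0 => y; exact: enorm_ge0.
have mP : measurable_fun [set: plane R] P.
  by apply: measurable_potential => // y; exact: enorm_ge0.
have iP : leb2.-integrable D P.
  apply/integrableP; split; first exact: measurable_funTS.
  by under eq_integral do rewrite gee0_abs//; exact: potential_fin_rect.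
pose un n x := (smooth_avg (scale n) u x)%:E.
have mun n : measurable_fun [set: plane R] (un n).
  by apply/measurable_EFinP; exact: measurable_smooth_avg.
(* The upper limit is defined and measurable everywhere, and is the limit wherever that exists. *)
pose V x := limn_esup (un ^~ x).
have mV : measurable_fun [set: plane R] V by exact: measurable_fun_limn_esup.
have aeP : {ae leb2, forall x, D x -> (P x < +oo)%E}.
  apply: filterS (integrable_ae mD iP) => x h /h.
  by rewrite ge0_fin_numE.
have cV x : (P x < +oo)%E -> un n x @[n --> \oo] --> V x.
  move=> Px; have c := cvg_smooth_avg hu hG Px.
  have ce : cvgn (un ^~ x).
    by apply/cvg_ex; exists (limn (fun n => smooth_avg (scale n) u x))%:E; apply: cvg_EFin => //; apply: nearW.
  by rewrite /V is_cvg_limn_esupE.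
pose g x := (`|smooth_avg 1 u x|%:E + (2 * pi)^-1%:E * P x)%E.
have ig : leb2.-integrable D g.
  apply: integrableD => //.
    have := integrable_abse (integrable_indic_rect (integrable_rect_avg p q ltr01 (lexx 1) hu)).
    by [].
  exact: integrableZl.
have ung x n : (`|un n x| <= g x)%E.
  by have := smooth_avg_le x (s0 n) (s1 n) hu hG; rewrite mulr1.
have sub p' q' : rect p' q' `<=` D ->
    (\int[leb2]_(x in rect p' q') un n x)%E @[n --> \oo] --> (\int[leb2]_(x in rect p' q') V x)%E /\
    leb2.-integrable (rect p' q') V.
  move=> hD; have mE := measurable_rect p' q'.
  have [] := @dominated_convergence _ _ _ leb2 (rect p' q') mE un V g
    (fun n => measurable_funTS (mun n)) (measurable_funTS mV).
  - by apply: filterS aeP => x h /hD /h; exact: cV.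
  - exact: integrableS ig.
  - by apply: aeW => x n _; exact: ung.
  by move=> iV _ cI.
have iV : leb2.-integrable D V by case: (sub p q (fun _ h => h)).
have iu : leb2.-integrable D (fun x => (u x)%:E) := integrable_rect p q hu.
have uV : ae_eq leb2 D (fun x => (u x)%:E) V.
  apply: integral_ae_eq => //; first exact: measurable_funTS.
  move=> E ED mE; rewrite -(setIidl ED); apply: eq_integral_rects => // p' q' hD.
  have [cI _] := sub _ _ hD.
  have := @cvg_integral_rect_avg R u p' q' hu.
  rewrite integral_indic_rect; under eq_fun do rewrite integral_indic_rect.
  by move=> cI'; exact: (cvg_unique _ cI' cI).
apply: filterS2 aeP uV => x h1 h2 Dx.
have := cV x (h1 Dx); rewrite -(h2 Dx).
by move/fine_cvgP => [].
Qed.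

Lemma ae_cvg_smooth_avg u G : locally_integrable2 u -> is_weak_gradient u G ->
  {ae leb2, forall x : plane R, smooth_avg (scale n) u x @[n --> \oo] --> u x}.
Proof.
move=> hu hG.
have := @ae_foralln _ _ _ leb2 _ (fun N => ae_cvg_smooth_avg_rect (- N%:R, - N%:R) (N%:R, N%:R) hu hG).
apply: filterS => x h.
pose N := (Num.truncn (`|x.1| + `|x.2|)).+1.
apply: (h N); rewrite /rect/= !in_itv/=.
have := truncnS_gt (`|x.1| + `|x.2|); rewrite -/N => hN.
have := (ler_norm x.1, ler_norm (- x.1), ler_norm x.2, ler_norm (- x.2)); rewrite !normrN => -[[[]]] *.
have := normr_ge0 x.1; have := normr_ge0 x.2 => *.
by split; apply/andP; split; lra.
Qed.

(** The exceptional set consists of points where the averages fail to converge to [u], hence is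
    common to all [b]; this is what later allows [b] to depend on [x]. *)
Lemma ae_pointwise_bound u G : locally_integrable2 u -> is_weak_gradient u G ->
  {ae leb2, forall x : plane R, forall b, 0 < b ->
    (`|u x|%:E <= `|smooth_avg b u x|%:E +
       (2 * pi)^-1%:E * potential (2 * b) (fun y => enorm (G y)) x)%E}.
Proof.
move=> hu hG; apply: filterS (ae_cvg_smooth_avg hu hG) => x cx b b0.
have cE : `|smooth_avg (scale n) u x|%:E @[n --> \oo] --> `|u x|%:E.
  by apply: cvg_EFin; [apply: nearW|exact: cvg_norm].
rewrite -(cvg_lim _ cE)//; apply: lime_le; first by apply/cvg_ex; eexists; exact: cE.
have := scale_small (mulr_gt0 (ltr0n R 2) b0); apply: filterS => n /=.
rewrite ltr_pM2l// => nb.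
by apply: smooth_avg_le => //; exact: scale_gt0.
Qed.

End identification.

(** * Hedberg's estimate of the potential *)

Section hedberg.
Context {R : realType}.
Implicit Types (x y : plane R) (f : plane R -> R).

Definition local_energy (s : R) f (w : R) x : \bar R :=
  (\int[leb2]_(y in disc x (2 / w)) (f y ^+ 2 * (sqdist x y * w) `^ (- s))%:E)%E.

Lemma local_energy_ge0 (s w : R) f x : (0 <= local_energy s f w x)%E.
Proof. by apply: integral_ge0 => y _; rewrite lee_fin mulr_ge0 ?powR_ge0 ?sqr_ge0. Qed.

(** The difference of the two sides is a square over a positive quantity. With [t] left free,
    optimising it after integration amounts to the Cauchy-Schwarz inequality. *)
Lemma weighted_amgm (t g r a : R) : 0 < t -> 0 < a -> 0 <= r -> 0 <= g ->
  g / Num.sqrt r <= t / 2 * (g ^+ 2 * a) + (2 * t)^-1 * (a * r)^-1.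
Proof.
move=> t0 a0 r0 g0.
have [->|rn0] := eqVneq r 0.
  by rewrite sqrtr0 mulr0 invr0 !mulr0 addr0 !mulr_ge0 ?sqr_ge0 ?invr_ge0 ?(ltW t0) ?(ltW a0).
have rp : 0 < r by rewrite lt0r rn0.
have sp : 0 < Num.sqrt r by rewrite sqrtr_gt0.
rewrite -{2}(sqr_sqrtr r0); move: (Num.sqrt r) sp => q q0.
rewrite -subr_ge0.
have -> : t / 2 * (g ^+ 2 * a) + (2 * t)^-1 * (a * q ^+ 2)^-1 - g / q =
   (t * g * a * q - 1) ^+ 2 / (2 * t * a * q ^+ 2).
  by field; rewrite !gt_eqF.
by rewrite divr_ge0 ?sqr_ge0// !mulr_ge0 ?sqr_ge0 ?(ltW t0) ?(ltW a0) ?(ltW q0).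
Qed.

Lemma potential_sqr_le (s e w : R) f x :
  0 < s -> s < 1 -> 0 < e -> 0 < w ->
  measurable_fun [set: plane R] f -> (forall y, 0 <= f y) ->
  (\int[leb2]_y (f y ^+ 2)%:E <= 1)%E ->
  (local_energy s f w x < +oo)%E ->
  exists2 I : R, potential (2 / w) f x = I%:E &
    I ^+ 2 <= (1 + e) * (pi / s * ln (1 + 2 `^ s * (1 + fine (local_energy s f w x)) / e)).
Proof.
move=> s0 s1 e0 w0 mf f0 f2 Vfin.
set v := fine _.
have VE : local_energy s f w x = v%:E.
  by rewrite fineK// ge0_fin_numE// local_energy_ge0.
have v0 : 0 <= v by rewrite fine_ge0// local_energy_ge0.
(* With [r = |y - x|^2] and [a] the weight below, [a r = r^(1 - s) (r^s + c)], so that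
   [integral_disc_log] applies to [(a r)^-1]. *)
pose c := e * w `^ (- s) / (1 + v).
have c0 : 0 < c by rewrite divr_gt0 ?mulr_gt0 ?powR_gt0// ltr_pwDl.
have b0 : 0 < 2 / w by rewrite divr_gt0.
set X := 1 + 2 `^ s * (1 + v) / e.
(* The powers of [w] in the radius and in [c] cancel, so the bound is the same at every scale. *)
have XE : X = 1 + (2 / w) `^ s / c.
  rewrite /X /c; congr (1 + _).
  rewrite powRM ?invr_ge0 ?(ltW w0)// powRN -(powR_inv1 (ltW w0)) -powRrM mulN1r powRN.
  have := powR_gt0 s w0; move: (w `^ s) (2 `^ s) => W T W0.
  by field; rewrite !gt_eqF// ltr_pwDl.
have X1 : 1 < X.
  by rewrite XE ltrDl divr_gt0 ?powR_gt0.
set Y := pi / s * ln X.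
have Y0 : 0 < Y by rewrite mulr_gt0 ?divr_gt0 ?pi_gt0 ?ln_gt0.
have e1 : 0 < 1 + e by rewrite ltr_pwDl// ltW.
(* The minimiser of [t / 2 * (1 + e) + Y / (2 t)]; the minimum is [t * (1 + e)], whose square is
   [(1 + e) * Y]. *)
pose t := Num.sqrt (Y / (1 + e)).
have t0 : 0 < t by rewrite sqrtr_gt0 divr_gt0.
have t2 : t ^+ 2 = Y / (1 + e) by rewrite sqr_sqrtr// divr_ge0// ltW.
(* The reciprocal of [a y * |y - x|^2] has a primitive in [|y - x|^2] of
   logarithmic size, while [a] costs only a factor [1 + e] in the energy. *)
pose a y := 1 + e / (1 + v) * (sqdist x y * w) `^ (- s).
have a0 y : 0 < a y.
  by rewrite ltr_pwDl// mulr_ge0 ?powR_ge0// divr_ge0 ?addr_ge0// ltW.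
pose D := disc x (2 / w).
have mD : measurable D by exact: measurable_disc.
have msq := measurable_sqdist1 x.
have mpw : measurable_fun [set: plane R] (fun y => (sqdist x y * w) `^ (- s)).
  by apply: (measurableT_comp (measurable_powR _)); exact: measurable_funM.
have ma : measurable_fun [set: plane R] a.
  by apply: measurable_funD => //; exact: measurable_funM.
have mf2 : measurable_fun [set: plane R] (fun y => f y ^+ 2) by exact: measurable_funX.
have mar : measurable_fun [set: plane R] (fun y => (a y * sqdist x y)^-1).
  apply: measurable_funV_ge0; last exact: measurable_funM.
  by move=> y; rewrite mulr_ge0 ?sqdist_ge0 ?(ltW (a0 y)).
(* The constant part of [a] contributes at most 1, the singular part [e v / (1 + v) <= e]; this is
   why [a] is normalised by [1 + v]. *)
have int1 : (\int[leb2]_(y in D) (f y ^+ 2 * a y)%:E <= (1 + e)%:E)%E.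
  rewrite (eq_integral (fun y => (f y ^+ 2)%:E + (e / (1 + v))%:E * (f y ^+ 2 * (sqdist x y * w) `^ (- s))%:E)%E); last first.
    by move=> y _; rewrite /a -EFinM -EFinD; congr EFin; ring.
  have k0 : 0 <= e / (1 + v) by rewrite divr_ge0 ?addr_ge0// ltW.
  rewrite ge0_integralD//; last 4 first.
  - by move=> y _; rewrite lee_fin sqr_ge0.
  - exact/measurable_EFinP/measurable_funTS.
  - by move=> y _; rewrite -EFinM lee_fin; do ?[apply: mulr_ge0 => //]; rewrite ?powR_ge0 ?sqr_ge0 ?f0 ?invr_ge0 ?addr_ge0 ?(ltW e0).
  - by apply: measurable_funeM; apply/measurable_EFinP/measurable_funTS/measurable_funM.
  rewrite EFinD; apply: leeD.
    apply: le_trans f2; apply: ge0_subset_integral => //.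
    - exact/measurable_EFinP.
    - by move=> y _; rewrite lee_fin sqr_ge0.
  rewrite ge0_integralZl//; last 2 first.
  - by apply/measurable_EFinP/measurable_funTS/measurable_funM.
  - by move=> y _; rewrite lee_fin; do ?[apply: mulr_ge0 => //]; rewrite ?powR_ge0 ?sqr_ge0 ?f0 ?invr_ge0 ?addr_ge0 ?(ltW e0).
  rewrite -/(local_energy s f w x) VE -EFinM lee_fin.
  rewrite mulrAC ler_pdivrMr ?ltr_pwDl// ler_pM2l//.
  by rewrite lerDr.
have int2 : (\int[leb2]_(y in D) ((a y * sqdist x y)^-1)%:E <= Y%:E)%E.
  rewrite /Y XE; apply: le_trans (integral_disc_log x s0 c0 b0).
  rewrite le_eqVlt; apply/orP; left; apply/eqP; apply: eq_integral => y _; congr EFin.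
  have := sqdist_ge0 x y; rewrite le_eqVlt => /predU1P[<-|r0].
    rewrite mulr0 invr0 powR0 ?mul0r//; lra.
  rewrite /a /c powRM ?sqdist_ge0 ?(ltW w0)// powRN.
  have -> : sqdist x y `^ (s - 1) = sqdist x y `^ s / sqdist x y.
    by rewrite powRD ?powR_inv1 ?(ltW r0)//; apply/implyP => _; rewrite gt_eqF.
  have := powR_gt0 s r0; have := powR_gt0 (- s) w0.
  have v1 : 0 < 1 + v by rewrite ltr_pwDl.
  move: (w `^ (- s)) (sqdist x y `^ s) (sqdist x y) r0 => W T r r0 W0 T0.
  have q0 : 0 < r `^ s * (1 + v) + e * W by rewrite addr_gt0 ?mulr_gt0.
  by field; rewrite !gt_eqF.
have le1 : (potential (2 / w) f x <= (t / 2 * (1 + e) + (2 * t)^-1 * Y)%:E)%E.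
  apply: (@le_trans _ _ (\int[leb2]_(y in D) ((t / 2)%:E * (f y ^+ 2 * a y)%:E + (2 * t)^-1%:E * ((a y * sqdist x y)^-1)%:E))%E).
    apply: ge0_le_integral => //.
    - by move=> y _; rewrite lee_fin divr_ge0 ?sqrtr_ge0.
    - apply/measurable_funTS/measurable_EFinP; apply: measurable_funM => //.
      exact: (measurableT_comp measurable_sqrt_sqdistV (measurable_pair1 x)).
    - by apply: emeasurable_funD; apply: measurable_funeM; apply/measurable_EFinP/measurable_funTS => //; exact: measurable_funM.
    - by move=> y _; rewrite -!EFinM -EFinD lee_fin; apply: weighted_amgm => //; exact: sqdist_ge0.
  have p1 : 0 <= t / 2 by rewrite divr_ge0// ltW.
  have p2 : 0 <= (2 * t)^-1 by rewrite invr_ge0 mulr_ge0// ltW.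
  have q1 y : 0 <= f y ^+ 2 * a y by rewrite mulr_ge0 ?sqr_ge0// ltW.
  have q2 y : 0 <= (a y * sqdist x y)^-1 by rewrite invr_ge0 mulr_ge0 ?sqdist_ge0// ltW.
  rewrite ge0_integralD//; last 4 first.
  - by move=> y _; rewrite -EFinM lee_fin mulr_ge0.
  - by apply: measurable_funeM; apply/measurable_EFinP/measurable_funTS/measurable_funM.
  - by move=> y _; rewrite -EFinM lee_fin mulr_ge0.
  - by apply: measurable_funeM; apply/measurable_EFinP/measurable_funTS.
  rewrite [leRHS]EFinD; apply: leeD; rewrite [leRHS]EFinM.
    rewrite ge0_integralZl//.
    - by rewrite lee_wpmul2l ?lee_fin.
    - exact/measurable_EFinP/measurable_funTS/measurable_funM.
    - by move=> y _; rewrite lee_fin.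
  rewrite ge0_integralZl//.
  - by rewrite lee_wpmul2l ?lee_fin.
  - exact/measurable_EFinP/measurable_funTS.
  - by move=> y _; rewrite lee_fin.
have P0 : (0 <= potential (2 / w) f x)%E by exact: potential_ge0.
exists (fine (potential (2 / w) f x)).
  by rewrite fineK// ge0_fin_numE// (le_lt_trans le1)// ltry.
set I := fine _.
have I0 : 0 <= I by rewrite fine_ge0.
have Ile : I <= t / 2 * (1 + e) + (2 * t)^-1 * Y.
  by rewrite -lee_fin fineK// ge0_fin_numE// (le_lt_trans le1)// ltry.
have YE : Y = t ^+ 2 * (1 + e) by rewrite t2 divfK// gt_eqF.
have {}Ile : I <= t * (1 + e).
  apply: le_trans Ile _; rewrite YE le_eqVlt; apply/orP; left; apply/eqP.
  by field; rewrite gt_eqF.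
apply: (@le_trans _ _ ((t * (1 + e)) ^+ 2)); first by rewrite ler_sqr ?nnegrE ?mulr_ge0 ?(ltW t0) ?(ltW e1).
by rewrite -/Y YE le_eqVlt; apply/orP; left; apply/eqP; ring.
Qed.

End hedberg.

(** * The logarithmic weight *)

Section weight.
Context {R : realType}.
Implicit Types (x y : plane R) (f : plane R -> R) (u : R * R -> R).

Definition weight (b : R) (x : R * R) : R := ln (b + enorm x).

Lemma enorm_triangle x y : enorm x <= enorm y + Num.sqrt (sqdist x y).
Proof.
have s0 := sqdist_ge0 x y.
rewrite -ler_sqr ?nnegrE ?addr_ge0 ?enorm_ge0 ?sqrtr_ge0// sqrrD !sqr_sqrtr ?addr_ge0 ?sqr_ge0//.
have : - (y.1 * (y.1 - x.1) + y.2 * (y.2 - x.2)) <= enorm y * Num.sqrt (sqdist x y).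
  apply: le_trans (ler_norm _) _; rewrite normrN.
  rewrite -ler_sqr ?nnegrE ?mulr_ge0 ?enorm_ge0 ?sqrtr_ge0// real_normK ?num_real//.
  rewrite exprMn !sqr_sqrtr ?addr_ge0 ?sqr_ge0// /sqdist.
  by have := sqr_ge0 (y.1 * (y.2 - x.2) - y.2 * (y.1 - x.1)); lra.
by rewrite /sqdist => h; lra.
Qed.

Lemma weight_ge b x : 1 < b -> ln b <= weight b x.
Proof.
move=> b1; have b0 : 0 < b by lra.
by rewrite /weight ler_ln ?posrE ?lerDl ?enorm_ge0// ltr_wpDr ?enorm_ge0.
Qed.

Lemma weight_gt0 b x : 1 < b -> 0 < weight b x.
Proof. by move=> b1; apply: lt_le_trans (weight_ge x b1); rewrite ln_gt0. Qed.

Lemma measurable_weight b : measurable_fun [set: plane R] (weight b).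
Proof.
apply: (measurableT_comp (@measurable_ln R)); apply: measurable_funD => //.
by apply: (@measurable_enorm R id); [exact: measurable_fst|exact: measurable_snd].
Qed.

(** [Num.sqrt (2 / ln b)] bounds the radius of every disc [|y - x|^2 < 2 / w(x)], because
    [w >= ln b]. *)
Definition weight_ratio (b : R) : R := 1 + ln (1 + Num.sqrt (2 / ln b)) / ln b.

Lemma weight_ratio_ge1 b : 1 < b -> 1 <= weight_ratio b.
Proof.
move=> b1; rewrite lerDl divr_ge0 ?ln_ge0 ?(ltW b1)//.
by rewrite lerDl sqrtr_ge0.
Qed.

(** With [D] that radius, [b + |x| <= (b + |y|)(1 + D)] since [b + |y| >= 1]; the additive
    [ln (1 + D)] becomes a factor because [w(y) >= ln b]. *)
Lemma weight_le_near b x y : 1 < b -> sqdist x y <= 2 / ln b ->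
  weight b x <= weight_ratio b * weight b y.
Proof.
move=> b1 h; have b0 : 0 < b by lra.
have l0 : 0 < ln b by rewrite ln_gt0.
set D := Num.sqrt (2 / ln b).
have D0 : 0 <= D by exact: sqrtr_ge0.
have sD : Num.sqrt (sqdist x y) <= D by exact: ler_wsqrtr.
have xy := enorm_triangle x y; have ey := enorm_ge0 y; have ex := enorm_ge0 x.
have by0 : 0 < b + enorm y by lra.
apply: (@le_trans _ _ (ln ((b + enorm y) * (1 + D)))).
  rewrite /weight ler_ln ?posrE ?mulr_gt0//; [nra|lra|lra].
rewrite lnM ?posrE//; last by lra.
rewrite /weight_ratio -/D mulrDl mul1r /weight lerD2l mulrAC.
rewrite ler_pdivlMr// ler_wpM2l ?ln_ge0 ?lerDl//.
exact: weight_ge.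
Qed.

(** The hypothesis is not symmetric in [x] and [y], but it implies [|y - x|^2 <= 2 / ln b], which
    is. *)
Lemma weight_le_disc b x y : 1 < b -> sqdist x y * weight b x < 2 ->
  weight b x <= weight_ratio b * weight b y /\ weight b y <= weight_ratio b * weight b x.
Proof.
move=> b1 h.
have l0 : 0 < ln b by rewrite ln_gt0.
have h' : sqdist x y <= 2 / ln b.
  rewrite ler_pdivlMr// (le_trans _ (ltW h))// ler_wpM2l ?sqdist_ge0//.
  exact: weight_ge.
by split; apply: weight_le_near => //; rewrite sqdistC.
Qed.

(** The integrand of [V(x) w(x)] on pairs of points, with the disc written as an indicator: the form
    that Tonelli's theorem requires. *)
Definition energy_kernel (s b : R) f (z : plane R * plane R) : \bar R :=
  (\1_`]-oo, 2[ (sqdist z.1 z.2 * weight b z.1) *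
   (f z.2 ^+ 2 * (sqdist z.1 z.2 * weight b z.1) `^ (- s)) * weight b z.1)%:E.

Lemma energy_kernel_ge0 (s b : R) f z : 1 < b -> (0 <= energy_kernel s b f z)%E.
Proof.
move=> b1; rewrite lee_fin; apply: mulr_ge0; last exact/ltW/weight_gt0.
by rewrite mulr_ge0// mulr_ge0 ?sqr_ge0 ?powR_ge0.
Qed.

Lemma measurable_energy_kernel (s b : R) f : measurable_fun [set: plane R] f ->
  measurable_fun [set: plane R * plane R] (energy_kernel s b f).
Proof.
move=> mf.
have mW1 : measurable_fun [set: plane R * plane R] (fun z => weight b z.1).
  exact: (measurableT_comp (measurable_weight b)).
have mq : measurable_fun [set: plane R * plane R] (fun z => sqdist z.1 z.2 * weight b z.1).
  by apply: measurable_funM => //; exact: measurable_sqdist.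
apply/measurable_EFinP; apply: measurable_funM => //; apply: measurable_funM => //.
  by apply: (measurableT_comp (f := \1_`]-oo, 2[ : R -> R)) => //; exact: measurable_indic (measurable_itv _).
apply: measurable_funM; first by apply: measurable_funX; exact: (measurableT_comp mf).
exact: (measurableT_comp (measurable_powR _)).
Qed.

Lemma local_energyE (s b : R) f x : 1 < b -> measurable_fun [set: plane R] f ->
  (local_energy s f (weight b x) x * (weight b x)%:E =
   \int[leb2]_y energy_kernel s b f (x, y))%E.
Proof.
move=> b1 mf; have W0 := weight_gt0 x b1.
rewrite /local_energy integral_mkcond -ge0_integralZr//; last 3 first.
- apply/(measurable_restrictT (fun y => (f y ^+ 2 * (sqdist x y * weight b x) `^ (- s))%:E) (measurable_disc x _)).
  apply/measurable_funTS/measurable_EFinP; apply: measurable_funM; first exact: measurable_funX.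
  apply: (measurableT_comp (measurable_powR _)); apply: measurable_funM => //.
  exact: measurable_sqdist1.
- by move=> y _; rewrite patchE; case: ifP => // _; rewrite lee_fin mulr_ge0 ?sqr_ge0 ?powR_ge0.
- by rewrite lee_fin ltW.
apply: eq_integral => y _; rewrite patchE /energy_kernel/= indicE.
case: ifPn; rewrite ?notin_setE ?inE /disc/= ltr_pdivlMr// => hy.
  by rewrite mem_set ?mul1r ?EFinM//= in_itv.
by rewrite memNset ?mul0r ?mul0e//= in_itv.
Qed.

Lemma measurable_local_energy (s b : R) f : 1 < b -> measurable_fun [set: plane R] f ->
  measurable_fun [set: plane R] (fun x => local_energy s f (weight b x) x * (weight b x)%:E)%E.
Proof.
move=> b1 mf; rewrite (_ : (fun _ => _) = fun x => (\int[leb2]_y energy_kernel s b f (x, y))%E).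
  by apply: (measurable_fun_fubini_tonelli_F (m2 := leb2) _ (measurable_energy_kernel s b mf)) => z; exact: energy_kernel_ge0.
by apply/funext => x; exact: local_energyE.
Qed.

Lemma integral_local_energy (s b : R) f : 0 < s -> s < 1 -> 1 < b ->
  measurable_fun [set: plane R] f ->
  (\int[leb2]_x (local_energy s f (weight b x) x * (weight b x)%:E) <=
   (pi * ((2 * weight_ratio b ^+ 2) `^ (1 - s) / (1 - s)))%:E * \int[leb2]_y (f y ^+ 2)%:E)%E.
Proof.
move=> s0 s1 b1 mf.
have W0 x := weight_gt0 x b1.
have L1 := weight_ratio_ge1 b1; set L := weight_ratio b in L1 *.
have L0 : 0 < L by lra.
have s1' : 0 < 1 - s by lra.
set C := pi * _.
have C0 : 0 <= C by rewrite mulr_ge0 ?pi_ge0// divr_ge0 ?powR_ge0// ltW.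
have h0 z : (0 <= energy_kernel s b f z)%E by exact: energy_kernel_ge0.
have mh := measurable_energy_kernel s b mf.
rewrite (eq_integral (fun x => \int[leb2]_y energy_kernel s b f (x, y))%E); last first.
  by move=> x _; exact: local_energyE.
rewrite (fubini_tonelli (m1 := leb2) (m2 := leb2))//.
rewrite -ge0_integralZl//; last 2 first.
- by apply/measurable_EFinP; exact: measurable_funX.
- by move=> y _; rewrite lee_fin sqr_ge0.
apply: ge0_le_integral => //.
- by move=> y _; exact: integral_ge0.
- exact: measurable_fun_fubini_tonelli_G.
- by apply: measurable_funeM; apply/measurable_EFinP; exact: measurable_funX.
move=> y _.
(* The centres [x] whose disc contains [y] satisfy [|y - x|^2 w(y) <= L |y - x|^2 w(x) < 2 L], hence
   lie in [disc y r]. In [k] the power [w(x)^(1 - s)] is replaced by its bound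
   [(L w(y))^(1 - s)]. *)
pose r := 2 * L / weight b y.
have r0 : 0 < r by rewrite divr_gt0 ?mulr_gt0.
pose k := f y ^+ 2 * (L * weight b y) `^ (1 - s).
have k0 : 0 <= k by rewrite mulr_ge0 ?sqr_ge0 ?powR_ge0.
apply: (@le_trans _ _ (\int[leb2]_(x in disc y r) (k%:E * (sqdist y x `^ (- s))%:E))%E).
  rewrite [leRHS]integral_mkcond; apply: ge0_le_integral => //.
  - exact: (measurableT_comp mh (measurable_pair2 y)).
  - apply/(measurable_restrictT (fun x => (k%:E * (sqdist y x `^ (- s))%:E)%E) (measurable_disc y r)).
    apply: measurable_funTS; apply: measurable_funeM; apply/measurable_EFinP.
    exact: (measurableT_comp (measurable_powR _) (measurable_sqdist1 y)).
  move=> x _; rewrite /energy_kernel/= indicE.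
  case: (boolP (_ \in _)) => [|_]; last first.
    rewrite !mul0r patchE; case: ifP => // _.
    by rewrite -EFinM lee_fin mulr_ge0 ?powR_ge0.
  rewrite inE/= in_itv/= => hxy.
  have [h1 h2] := weight_le_disc b1 hxy.
  rewrite patchE mem_set; last first.
    rewrite /disc/= /r ltr_pdivlMr// sqdistC.
    apply: le_lt_trans (ler_wpM2l (sqdist_ge0 x y) h2) _.
    by rewrite mulrCA -/L mulrC ltr_pM2r.
  rewrite mul1r -EFinM lee_fin /k (sqdistC y x) -[leLHS]mulrA -[leRHS]mulrA ler_wpM2l ?sqr_ge0//.
  have [r00|rn0] := eqVneq (sqdist x y) 0.
    by rewrite r00 mul0r powR0 ?mul0r ?mulr0//; lra.
  have rp : 0 < sqdist x y by rewrite lt0r rn0 sqdist_ge0.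
  rewrite powRM ?sqdist_ge0 ?(ltW (W0 _))// -mulrA [leRHS]mulrC ler_wpM2l ?powR_ge0//.
  have -> : weight b x `^ (- s) * weight b x = weight b x `^ (1 - s).
    rewrite -{2}(powRr1 (ltW (W0 x))) -powRD; first by congr (_ `^ _); lra.
    by apply/implyP => _; rewrite gt_eqF.
  by apply: ge0_ler_powR => //; rewrite ?nnegrE ?mulr_ge0 ?(ltW (W0 _)) ?(ltW L0) ?(ltW s1').
rewrite ge0_integralZl//; last 3 first.
- exact: measurable_disc.
- apply: measurable_funTS; apply/measurable_EFinP.
  exact: (measurableT_comp (measurable_powR _) (measurable_sqdist1 y)).
- by move=> x _; rewrite lee_fin powR_ge0.
apply: (@le_trans _ _ (k%:E * (pi * (r `^ (1 - s) / (1 - s)))%:E)%E).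
  by rewrite lee_wpmul2l ?lee_fin// integral_disc_powR.
rewrite -!EFinM lee_fin /k /C le_eqVlt; apply/orP; left; apply/eqP.
(* The weight at [y] cancels between [k] and [r], leaving a constant independent of [y]. *)
have -> : 2 * L ^+ 2 = L * weight b y * r.
  by rewrite /r; field; rewrite gt_eqF.
rewrite [(_ * r) `^ _]powRM ?(ltW r0) ?mulr_ge0 ?(ltW (W0 _)) ?(ltW L0)//.
ring.
Qed.

End weight.

(** * The Moser-Trudinger bound *)

Section numeric.
Context {R : realType}.

Lemma le_add1_powR (t p : R) : 0 <= t -> 1 <= p -> t <= 1 + t `^ p.
Proof.
move=> t0 p1; have [t1|t1] := leP t 1; first by rewrite (le_trans t1)// lerDl powR_ge0.
by apply: (@le_trans _ _ (t `^ p)); rewrite ?lerDr// -{1}(powRr1 t0) ler_powR// ltW.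
Qed.

(** For [t >= 1], [t^p] is at most [t^(2 (n + 1))] with [n + 1 > |p|], which is controlled by one
    term of the exponential series. *)
Lemma powR_le_expR_sqr (p eta : R) : 0 < eta ->
  exists2 C : R, 0 < C & forall t, 1 <= t -> t `^ p <= C * expR (eta * t ^+ 2).
Proof.
move=> e0; pose n := Num.truncn `|p|.
exists ((n.+1)`!%:R / eta ^+ n.+1).
  by rewrite divr_gt0 ?exprn_gt0// ltr0n fact_gt0.
move=> t t1; have t0 : 0 <= t by lra.
have h := expR_ge1Dxn n (mulr_ge0 (ltW e0) (sqr_ge0 t)).
have F0 : 0 < (n.+1)`!%:R :> R by rewrite ltr0n fact_gt0.
have E0 : 0 < eta ^+ n.+1 by rewrite exprn_gt0.
apply: (@le_trans _ _ ((t ^+ 2) ^+ n.+1)).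
  rewrite -exprM -powR_mulrn// ler_powR//.
  apply: le_trans (ler_norm _) _; apply: le_trans (ltW (truncnS_gt `|p|)) _.
  by rewrite ler_nat leq_pmull.
have : (eta * t ^+ 2) ^+ n.+1 / (n.+1)`!%:R <= expR (eta * t ^+ 2).
  by apply: le_trans h; rewrite lerDr.
rewrite ler_pdivrMr// exprMn => {}h.
by rewrite mulrAC ler_pdivlMr// mulrC [leRHS]mulrC.
Qed.

(** One factor [1 + e] comes from [potential_sqr_le], the other from splitting the square of average
    plus potential. *)
Lemma exponents (beta : R) : 0 < beta -> beta < 4 * pi ->
  exists s e : R, [/\ 0 < s, s < 1, 0 < e & (1 + e) ^+ 2 * beta <= 4 * pi * s].
Proof.
move=> b0 b4; have P0 : 0 < 4 * pi :> R by rewrite mulr_gt0 ?pi_gt0.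
move: (4 * pi) P0 b4 => P P0 bP.
(* The midpoint of [beta / P] and 1, so that [P * s / beta > 1]. *)
pose s := (beta / P + 1) / 2.
have r0 : 0 < beta / P by rewrite divr_gt0.
have r1 : beta / P < 1 by rewrite ltr_pdivrMr// mul1r.
have s0 : 0 < s by rewrite /s; lra.
have s1 : s < 1 by rewrite /s; lra.
(* For [0 <= e <= 1] one has [(1 + e)^2 <= 1 + 3 e]; hence the division by 3 and the minimum with
   1. *)
pose d := (P * s / beta - 1) / 3.
have d0 : 0 < d.
  rewrite /d divr_gt0// subr_gt0 ltr_pdivlMr// mul1r mulrC -ltr_pdivrMr// /s; lra.
have mP : 0 < Num.min 1 d by rewrite lt_min ltr01 d0.
have m1 : Num.min 1 d <= 1 by rewrite ge_min lexx.
have m2 : Num.min 1 d <= d by rewrite ge_min lexx orbT.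
move: (Num.min 1 d) mP m1 m2 => e e0 e1 ed.
exists s, e; split => //.
rewrite -ler_pdivlMr//.
apply: (@le_trans _ _ (1 + 3 * d)); first by nra.
by rewrite /d le_eqVlt; apply/orP; left; apply/eqP; field; rewrite gt_eqF.
Qed.

(** For [t < 1] the exponential is at most [expR |alpha|]. For [t >= 1] the exponential of the
    logarithm is linear in [1 + v], and [1 <= t^p] removes the constant, which would not be
    integrable over the plane. *)
Lemma pointwise_growth (p alpha A : R) : 0 <= p -> alpha < 4 * pi -> 0 <= A ->
  exists s e C : R, [/\ 0 < s, s < 1, 0 < e, 0 < C &
    forall t I v, 0 <= t -> 0 <= v -> 0 <= I -> t <= A + (2 * pi)^-1 * I ->
      I ^+ 2 <= (1 + e) * (pi / s * ln (1 + 2 `^ s * (1 + v) / e)) ->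
      t `^ p * expR (alpha * t ^+ 2) <= C * (t `^ p + v)].
Proof.
move=> p0 a4 A0; have P0 := pi_gt0 R.
(* Strictly between [alpha] and 4 pi, and positive even for negative [alpha]. The gap [beta - alpha]
   absorbs [t^p]; the gap below 4 pi leaves room for [s] and [e]. *)
pose beta := (Num.max alpha 0 + 4 * pi) / 2.
have mx : Num.max alpha 0 < 4 * pi by rewrite gt_max a4 mulr_gt0.
have mx0 : 0 <= Num.max alpha 0 by rewrite le_max lexx orbT.
have mxa : alpha <= Num.max alpha 0 by rewrite le_max lexx.
have b0 : 0 < beta by rewrite /beta; lra.
have b4 : beta < 4 * pi by rewrite /beta; lra.
have ab : 0 < beta - alpha by rewrite /beta; lra.
have [s [e [s0 s1 e0 he]]] := exponents b0 b4.
have [C1 C10 hC1] := powR_le_expR_sqr p ab.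
pose C2 := C1 * expR (beta * ((1 + e^-1) * A ^+ 2)) * (1 + 2 `^ s / e).
have T0 : 0 < 2 `^ s / e by rewrite divr_gt0 ?powR_gt0.
have C20 : 0 < C2 by rewrite !mulr_gt0 ?expR_gt0//; lra.
exists s, e, (expR `|alpha| + C2); split => //; first by rewrite addr_gt0 ?expR_gt0.
move=> t I v t0 v0 I0 tle I2.
have [t1|t1] := ltP t 1.
  apply: (@le_trans _ _ (expR `|alpha| * t `^ p)).
    rewrite mulrC ler_wpM2r ?powR_ge0// ler_expR.
    apply: le_trans (ler_norm _) _; rewrite normrM ler_piMr// ger0_norm ?sqr_ge0//.
    by rewrite expr_le1// ltW.
  apply: ler_pM; rewrite ?expR_ge0 ?powR_ge0// ?lerDl// ltW//.
set X := 1 + 2 `^ s * (1 + v) / e in I2.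
have X0 : 0 < X by rewrite /X ltr_pwDl// divr_ge0 ?mulr_ge0 ?powR_ge0 ?(ltW e0)// addr_ge0.
have Xle : X <= (1 + 2 `^ s / e) * (1 + v).
  by rewrite /X -mulrA [(1 + v) / e]mulrC mulrA; nra.
set J := (2 * pi)^-1 * I in tle.
have J0 : 0 <= J by rewrite mulr_ge0 ?invr_ge0 ?mulr_ge0 ?(ltW P0).
(* The origin of the critical constant: [(2 pi)^-2] times [pi / s] is [1 / (4 pi s)]. *)
have J2 : 4 * pi * s * J ^+ 2 <= (1 + e) * ln X.
  have -> : 4 * pi * s * J ^+ 2 = s / pi * I ^+ 2.
    by rewrite /J; move: (@pi R) P0 => P P0'; field; rewrite gt_eqF.
  apply: (@le_trans _ _ (s / pi * ((1 + e) * (pi / s * ln X)))).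
    by rewrite ler_wpM2l ?divr_ge0 ?(ltW s0) ?(ltW P0).
  rewrite le_eqVlt; apply/orP; left; apply/eqP.
  by move: (@pi R) P0 (ln X) => P P0' l; field; rewrite !gt_eqF.
(* Young's inequality with parameter [e] on the cross term: the average [A] takes the large constant
   and the potential only [1 + e]. *)
have tt : t ^+ 2 <= (1 + e) * J ^+ 2 + (1 + e^-1) * A ^+ 2.
  apply: (@le_trans _ _ ((A + J) ^+ 2)); first by rewrite ler_sqr ?nnegrE ?addr_ge0.
  rewrite -subr_ge0.
  have -> : (1 + e) * J ^+ 2 + (1 + e^-1) * A ^+ 2 - (A + J) ^+ 2 = (e * J - A) ^+ 2 / e.
    by field; rewrite gt_eqF.
  by rewrite divr_ge0 ?sqr_ge0// ltW.
have bJ : beta * ((1 + e) * J ^+ 2) <= ln X.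
  have h1 : (1 + e) ^+ 2 * beta * J ^+ 2 <= (1 + e) * ln X.
    by apply: le_trans J2; rewrite ler_wpM2r ?sqr_ge0.
  have e1 : 0 < 1 + e by lra.
  rewrite -(ler_pM2l e1); apply: le_trans h1; rewrite le_eqVlt; apply/orP; left; apply/eqP; ring.
have be : expR (beta * t ^+ 2) <= expR (beta * ((1 + e^-1) * A ^+ 2)) * X.
  have XE : expR (ln X) = X by rewrite lnK// posrE.
  rewrite -XE -expRD ler_expR.
  apply: le_trans (ler_wpM2l (ltW b0) tt) _.
  by rewrite mulrDr addrC lerD2l.
apply: (@le_trans _ _ (C1 * expR (beta * t ^+ 2))).
  apply: (@le_trans _ _ (C1 * expR ((beta - alpha) * t ^+ 2) * expR (alpha * t ^+ 2))).
    by rewrite ler_wpM2r ?expR_ge0// hC1.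
  by rewrite -mulrA -expRD -mulrDl subrK.
apply: (@le_trans _ _ (C2 * (1 + v))).
  rewrite /C2 -mulrA -mulrA ler_pM2l//.
  apply: (le_trans be).
  by rewrite ler_pM2l ?expR_gt0.
have tp1 : 1 <= t `^ p.
  have : 1 `^ p <= t `^ p by apply: ge0_ler_powR; rewrite ?nnegrE.
  by rewrite powR1.
have E0 := expR_gt0 `|alpha|.
apply: (@le_trans _ _ (C2 * (t `^ p + v))); first by rewrite ler_pM2l// lerD2r.
by rewrite ler_wpM2r ?lerDr ?addr_ge0 ?powR_ge0// ltW.
Qed.

End numeric.

Section conclusion.
Context {R : realType}.
Implicit Types (x y : plane R) (u : R * R -> R).

Lemma measurable_absR_powR u (p : R) : measurable_fun [set: plane R] u ->
  measurable_fun [set: plane R] (fun y => `|u y| `^ p).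
Proof.
by move=> mu; apply: (measurableT_comp (measurable_powR _)); exact: measurableT_comp.
Qed.

(** The inequality [|u| <= 1 + |u|^p] takes the place of Hoelder's: the bump has mass 1, and near
    [x] its height [K / c = K w(x)] is at most [K L w(y)], which produces the weighted integral. *)
Lemma smooth_avg_bound (p b B K : R) u x : 1 <= p -> 1 < b -> 0 <= B -> 0 < K ->
  (forall c (x y : plane R), 0 < c -> kap c x y <= K / c) ->
  locally_integrable2 u ->
  (\int[leb2]_y (`|u y| `^ p * weight b y)%:E <= B%:E)%E ->
  `|smooth_avg (weight b x)^-1 u x| <= 1 + K * weight_ratio b * B.
Proof.
move=> p1 b1 B0 K0 hK hu hB; have mu : measurable_fun [set: plane R] u by case: hu.
have W0 y := weight_gt0 y b1.
have c0 : 0 < (weight b x)^-1 by rewrite invr_gt0.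
set c := (weight b x)^-1 in c0 *.
have L1 := weight_ratio_ge1 b1; set L := weight_ratio b in L1 *.
have ik := integrable_kap x c0 hu.
have mk : measurable_fun [set: plane R] (kap c x).
  exact: (measurableT_comp (measurable_kap c) (measurable_pair1 x)).
have mup := measurable_absR_powR p mu.
have mw := measurable_weight b.
rewrite -lee_fin EFin_normr_Rintegral//.
apply: le_trans (le_abse_integral _ _ _) _ => //; first by case/integrableP: ik.
apply: (@le_trans _ _ (\int[leb2]_y ((kap c x y)%:E + (K * L)%:E * (`|u y| `^ p * weight b y)%:E))%E).
  apply: ge0_le_integral => //.
  - by apply: measurableT_comp => //; case/integrableP: ik.
  - apply: emeasurable_funD; first exact/measurable_EFinP.
    by apply: measurable_funeM; apply/measurable_EFinP; exact: measurable_funM.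
  move=> y _; rewrite -EFinM -EFinD lee_fin.
  have rhs0 : 0 <= K * L * (`|u y| `^ p * weight b y).
    by rewrite !mulr_ge0 ?powR_ge0 ?(ltW K0) ?(ltW (W0 y))//; lra.
  have [hy|hy] := leP (2 * c) (sqdist x y).
    by rewrite kap_eq0 ?mulr0 ?normr0 ?add0r.
  have [h1 h2] : weight b x <= L * weight b y /\ weight b y <= L * weight b x.
    by apply: weight_le_disc => //; rewrite -ltr_pdivlMr.
  have k0 := kap_ge0 x y c0.
  rewrite normrM (ger0_norm k0).
  apply: (@le_trans _ _ ((1 + `|u y| `^ p) * kap c x y)).
    by rewrite ler_wpM2r// le_add1_powR.
  rewrite mulrDl mul1r lerD2l mulrC.
  rewrite [leRHS](_ : _ = (K * (L * weight b y)) * `|u y| `^ p); last by ring.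
  rewrite ler_wpM2r ?powR_ge0//.
  apply: le_trans (hK c x y c0) _.
  by rewrite /c invrK ler_wpM2l// ltW.
rewrite ge0_integralD//; last 4 first.
- by move=> y _; rewrite lee_fin kap_ge0.
- exact/measurable_EFinP.
- move=> y _; rewrite -EFinM lee_fin !mulr_ge0 ?powR_ge0 ?(ltW K0) ?(ltW (W0 y))//; lra.
- by apply: measurable_funeM; apply/measurable_EFinP; exact: measurable_funM.
rewrite integral_kap// EFinD leeD2l// ge0_integralZl//.
- by rewrite [leRHS]EFinM lee_wpmul2l// lee_fin mulr_ge0 ?(ltW K0)//; lra.
- by apply/measurable_EFinP; exact: measurable_funM.
- by move=> y _; rewrite lee_fin mulr_ge0 ?powR_ge0 ?(ltW (W0 y)).
- rewrite lee_fin mulr_ge0 ?(ltW K0)//; lra.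
Qed.

Lemma poweR_inv_le (Z : \bar R) (p M : R) : 0 < p -> 0 <= M -> (0 <= Z)%E ->
  (Z `^ p^-1 <= M%:E)%E -> (Z <= (M `^ p)%:E)%E.
Proof.
move=> p0 M0 Z0 h; rewrite -(poweRe1 Z0) -(mulVf (lt0r_neq0 p0)) poweRrM -poweR_EFin.
by apply: (gt0_ler_poweR (ltW p0)); rewrite // in_itv/= ?poweR_ge0 ?lee_fin ?M0 leey.
Qed.

Lemma moser_bound (p b alpha M : R) : 2 < p -> 1 < b -> alpha < 4 * pi -> 0 < M ->
  exists C : R, forall u : R * R -> R, D12Lp p b u -> (gradnorm2 u <= 1)%E ->
    (wnorm p b u <= M%:E)%E ->
    (\int[leb2]_x (`|u x| `^ p * expR (alpha * u x ^+ 2) * weight b x)%:E <= C%:E)%E.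
Proof.
move=> p2 b1 ha M0.
have p0 : 0 < p by lra.
have [K K0 hK] := @kap_bounded R.
pose B := M `^ p; have B0 : 0 <= B by exact: powR_ge0.
have L1 := weight_ratio_ge1 b1.
pose A := 1 + K * weight_ratio b * B.
have A0 : 0 <= A by rewrite addr_ge0// !mulr_ge0 ?(ltW K0)//; lra.
have [s [e [C [s0 s1 e0 C0 hC]]]] := pointwise_growth (ltW p0) ha A0.
pose C3 : R := pi * ((2 * weight_ratio b ^+ 2) `^ (1 - s) / (1 - s)).
have C30 : 0 <= C3 by rewrite mulr_ge0 ?pi_ge0// divr_ge0 ?powR_ge0//; lra.
(* [B] bounds the weighted integral of [|u|^p] and [C3] that of the local energy, the gradient
   having norm at most 1. Every constant is fixed before [u], hence uniform. *)
exists (C * (B + C3)) => u [hu [G0 hG0] _ _] gu wu.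
pose G := weak_gradient u.
(* The choice made by [get] is a weak gradient because membership in the space provides one. *)
have hG : is_weak_gradient u G by exact: (@getI _ (is_weak_gradient u) G0 hG0).
have [hG1 hG2 _ _] := hG.
have mu : measurable_fun [set: plane R] u by case: hu.
pose f (y : plane R) := enorm (G y).
have f0 y : 0 <= f y by exact: enorm_ge0.
have mf : measurable_fun [set: plane R] f.
  by apply: measurable_enorm; [case: hG1|case: hG2].
have f2 : (\int[leb2]_y (f y ^+ 2)%:E <= 1)%E.
  have -> : 1%E = ((1 : R) `^ 2)%:E by rewrite powR1.
  apply: poweR_inv_le => //.
    by apply: integral_ge0 => y _; rewrite lee_fin sqr_ge0.
  move: gu; rewrite /gradnorm2 unlock; congr (_ `^ _ <= _)%E.
  apply: eq_integral => y _; rewrite /= ger0_norm ?enorm_ge0//.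
  by congr EFin; exact: (powR_mulrn 2 (f0 y)).
have W0 (x : plane R) := weight_gt0 x b1.
have mw := measurable_weight b.
have mup := measurable_absR_powR p mu.
have muw : (\int[leb2]_y (`|u y| `^ p * weight b y)%:E <= B%:E)%E.
  apply: poweR_inv_le => //; first exact: ltW.
  by apply: integral_ge0 => y _; rewrite lee_fin mulr_ge0 ?powR_ge0 ?(ltW (W0 y)).
pose V x := local_energy s f (weight b x) x.
have V0 x : (0 <= V x)%E by exact: local_energy_ge0.
have mV : measurable_fun [set: plane R] (fun x => V x * (weight b x)%:E)%E.
  exact: measurable_local_energy.
have key : {ae leb2, forall x : plane R, [set: plane R] x ->
    ((`|u x| `^ p * expR (alpha * u x ^+ 2) * weight b x)%:E <=
     C%:E * ((`|u x| `^ p * weight b x)%:E + V x * (weight b x)%:E))%E}.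
  apply: filterS (ae_pointwise_bound hu hG) => x hx _.
  (* Where the local energy is infinite, so is the right side, as [C] and the weight are
     positive. *)
  have [Vfin|] := ltP (V x) +oo%E; last first.
    rewrite leye_eq => /eqP ->.
    by rewrite mulyr gtr0_sg ?W0// mul1e addey// mulry gtr0_sg// mul1e leey.
  have c0 : 0 < (weight b x)^-1 by rewrite invr_gt0.
  have [I PI I2] := potential_sqr_le s0 s1 e0 (W0 x) mf f0 f2 Vfin.
  have I0 : 0 <= I by rewrite -lee_fin -PI potential_ge0.
  have := hx _ c0; rewrite [potential _ _ _]PI -EFinM -EFinD lee_fin => hu1.
  have hb := smooth_avg_bound x (_ : 1 <= p) b1 B0 K0 hK hu muw.
  have VE : V x = (fine (V x))%:E by rewrite fineK// ge0_fin_numE.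
  have := hC `|u x| I (fine (V x)) (normr_ge0 _) _ I0 _ I2.
  rewrite real_normK ?num_real// => h.
  rewrite VE -(EFinM (fine _)) -EFinD -EFinM lee_fin -mulrDl mulrA ler_wpM2r ?(ltW (W0 x))//.
  apply: h; first by rewrite fine_ge0.
  by apply: le_trans hu1 _; rewrite lerD2r; apply: hb; lra.
have m1 : measurable_fun [set: plane R] (fun x => (`|u x| `^ p * weight b x)%:E).
  by apply/measurable_EFinP; exact: measurable_funM.
have n1 (x : plane R) : (0 <= (`|u x| `^ p * weight b x)%:E)%E.
  by rewrite lee_fin mulr_ge0 ?powR_ge0 ?(ltW (W0 x)).
have n2 x : (0 <= V x * (weight b x)%:E)%E by rewrite mule_ge0// lee_fin ltW.
apply: (@le_trans _ _ (\int[leb2]_x (C%:E * ((`|u x| `^ p * weight b x)%:E + V x * (weight b x)%:E)))%E).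
  apply: ae_ge0_le_integral => //.
  - by move=> x _; rewrite lee_fin !mulr_ge0 ?powR_ge0 ?expR_ge0 ?(ltW (W0 x)).
  - apply/measurable_EFinP; apply: measurable_funM => //; apply: measurable_funM => //.
    apply: (measurableT_comp (@measurable_expR R)); apply: measurable_funM => //.
    exact: measurable_funX.
  - by move=> x _; rewrite mule_ge0 ?lee_fin ?(ltW C0)// adde_ge0.
  - by apply: measurable_funeM; exact: emeasurable_funD.
rewrite ge0_integralZl//; last 3 first.
- exact: emeasurable_funD.
- by move=> x _; rewrite adde_ge0.
- by rewrite lee_fin ltW.
rewrite ge0_integralD// EFinM lee_wpmul2l ?lee_fin ?(ltW C0)//.
rewrite EFinD leeD//.
apply: le_trans (integral_local_energy s0 s1 b1 mf) _.
by rewrite -[leRHS]mule1 lee_wpmul2l ?lee_fin.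
Qed.

End conclusion.

Unset Implicit Arguments.

Theorem theorem2p9 (R : realType) (p b : R) (hp : 2 < p) (hb : 1 < b)
    (alpha M : R) (halpha : alpha < 4 * pi) (hM : 0 < M) :
  (ereal_sup
     [set \int[lebesgue2 R]_x
            (`|u x| `^ p * expR (alpha * u x ^+ 2) * ln (b + enorm x))%:E
     | u in [set u : R * R -> R |
               [/\ D12Lp p b u, gradnorm2 u <= 1 & wnorm p b u <= M%:E]]]
   < +oo)%E.
Proof.
have [C hC] := moser_bound hp hb halpha hM.
apply: (@le_lt_trans _ _ C%:E); last exact: ltry.
by apply: ge_ereal_sup => _ [u [hu gu wu] <-]; exact: hC.
Qed.
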